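(* Let $s,t,p\ge1$ with $t\ge s$ and $t\ge p$, $A,B\in GL(n)$, $Q\in\mathcal{P}(n)$, and consider $$Y^{s/t}+A^*Y^{-1}A+B^*Y^{-p/t}B=Q.\qquad( ** )$$ Let $a=\lambda_n(AQ^{-1}A^* )$. Suppose there is a real $b>0$ such that, with $\theta=b^{-1}\lambda_n(A^*A)$: (i) $b>a$; (ii) $Q\ge b^{-1}A^*A+b^{s/t}I+a^{-p/t}B^*B$; (iii) $s\|A\|^2<\tfrac12 t\theta^2a^{1-s/t}$; (iv) $p\|B\|^2<s\,a^{(p+s)/t}$. Define $F(X,Y)=A\big(Q-X^{s/t}-B^*Y^{-p/t}B\big)^{-1}A^*$ for $X,Y\in[aI,bI]$. Then: (I) $( ** )$ has a unique Hermitian positive definite solution $\bar X\in[aI,bI]$ (i.e. unique $\bar X\in[aI,bI]$ with $F(\bar X,\bar X)=\bar X$); (II) $\bar X\in[F(aI,bI),F(bI,aI)]$; (III) the sequences $X_0=aI$, $Y_0=bI$, $X_{n+1}=A(Q-X_n^{s/t}-B^*Y_n^{-p/t}B)^{-1}A^*$, $Y_{n+1}=A(Q-Y_n^{s/t}-B^*X_n^{-p/t}B)^{-1}A^*$ both converge to $\bar X$, and $$\max\{\|X_n-\bar X\|,\|Y_n-\bar X\|\}\le\frac{\delta^n}{1-\delta}\max\{\|X_1-X_0\|,\|Y_1-Y_0\|\},$$ where $\delta=2\max\big\{\tfrac st\|A\|^2\theta^{-2}a^{\frac st-1},\ \tfrac pt\|A\|^2\|B\|^2\theta^{-2}a^{-\frac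 pt-1}\big\}<1$. Consequently the equation $X^s+A^*X^{-t}A+B^*X^{-p}B=Q$ has a unique Hermitian positive definite solution $\bar X^{1/t}$ in $[a^{1/t}I,b^{1/t}I]$.
   Context: $GL(n)$: $n\times n$ complex nonsingular matrices; $\mathcal{P}(n)$: $n\times n$ Hermitian positive definite matrices. For Hermitian $M$, $\lambda_n(M)$ is its smallest eigenvalue. $\|\cdot\|$ is the spectral norm. For Hermitian $P,R$, $P\le R$ means $R-P$ is positive semidefinite, and $[P,R]=\{X \text{ Hermitian}: P\le X\le R\}$. Real powers of positive definite matrices are defined by functional calculus. *)

(* Defs.v *)
From Stdlib Require Import Reals Lra ClassicalEpsilon.
From Stdlib Require Fin.
Open Scope R_scope.

Record C := mkC { Cre : R ; Cim : R }.
Definition C0 : C := mkC 0 0.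
Definition C1 : C := mkC 1 0.
Definition RtoC (x : R) : C := mkC x 0.
Definition Cadd (z w : C) : C := mkC (Cre z + Cre w) (Cim z + Cim w).
Definition Copp (z : C) : C := mkC (- Cre z) (- Cim z).
Definition Cmul (z w : C) : C :=
  mkC (Cre z * Cre w - Cim z * Cim w) (Cre z * Cim w + Cim z * Cre w).
Definition Cconj (z : C) : C := mkC (Cre z) (- Cim z).

Fixpoint fsum (n : nat) : (Fin.t n -> C) -> C :=
  match n with
  | O => fun _ => C0
  | S m => fun f => Cadd (f Fin.F1) (fsum m (fun i => f (Fin.FS i)))
  end.

Definition Vec (n : nat) := Fin.t n -> C.
Definition Mat (n : nat) := Fin.t n -> Fin.t n -> C.

Definition vzero {n} : Vec n := fun _ => C0.
Definition vdot {n} (u v : Vec n) : C := fsum n (fun i => Cmul (Cconj (u i)) (v i)).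
Definition vnorm {n} (v : Vec n) : R := sqrt (Cre (vdot v v)).

Definition madd {n} (M N : Mat n) : Mat n := fun i j => Cadd (M i j) (N i j).
Definition msub {n} (M N : Mat n) : Mat n := fun i j => Cadd (M i j) (Copp (N i j)).
Definition mmul {n} (M N : Mat n) : Mat n :=
  fun i j => fsum n (fun k => Cmul (M i k) (N k j)).
Definition adj {n} (M : Mat n) : Mat n := fun i j => Cconj (M j i).
Definition mvmul {n} (M : Mat n) (v : Vec n) : Vec n :=
  fun i => fsum n (fun k => Cmul (M i k) (v k)).
Definition diag {n} (d : Fin.t n -> R) : Mat n :=
  fun i j => if Fin.eq_dec i j then RtoC (d i) else C0.
Definition smat {n} (c : R) : Mat n := diag (fun _ => c).
Definition mI {n} : Mat n := smat 1.

Definition hermitian {n} (M : Mat n) : Prop := adj M = M.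
Definition unitary {n} (U : Mat n) : Prop := mmul (adj U) U = mI /\ mmul U (adj U) = mI.
Definition invertible {n} (M : Mat n) : Prop :=
  exists N : Mat n, mmul M N = mI /\ mmul N M = mI.
Definition psd {n} (M : Mat n) : Prop :=
  hermitian M /\ forall v : Vec n, 0 <= Cre (vdot v (mvmul M v)).
Definition pd {n} (M : Mat n) : Prop :=
  hermitian M /\ forall v : Vec n, v <> vzero -> 0 < Cre (vdot v (mvmul M v)).
Definition mle {n} (P R0 : Mat n) : Prop := psd (msub R0 P).
Definition in_interval {n} (P R0 X : Mat n) : Prop :=
  hermitian X /\ mle P X /\ mle X R0.

Definition minv {n} (M : Mat n) : Mat n :=
  epsilon (inhabits M) (fun N => mmul M N = mI /\ mmul N M = mI).

Definition is_eigval {n} (M : Mat n) (l : R) : Prop :=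
  exists v : Vec n, v <> vzero /\ mvmul M v = (fun i => Cmul (RtoC l) (v i)).
(* lambda_n(M): the smallest eigenvalue (for Hermitian M) *)
Definition lmin {n} (M : Mat n) : R :=
  epsilon (inhabits 0) (fun l => is_eigval M l /\ forall m, is_eigval M m -> l <= m).

Definition mnorm {n} (M : Mat n) : R :=
  epsilon (inhabits 0)
    (fun c => is_lub (fun x => exists v : Vec n, vnorm v = 1 /\ x = vnorm (mvmul M v)) c).

Definition mpow {n} (X : Mat n) (r : R) : Mat n :=
  epsilon (inhabits X) (fun Y => exists (U : Mat n) (d : Fin.t n -> R),
    unitary U /\ (forall i, 0 < d i) /\
    X = mmul U (mmul (diag d) (adj U)) /\
    Y = mmul U (mmul (diag (fun i => Rpower (d i) r)) (adj U))).

Definition Fmap {n} (s t p : R) (A B Q X Y : Mat n) : Mat n :=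
  mmul A (mmul (minv (msub (msub Q (mpow X (s / t)))
                           (mmul (adj B) (mmul (mpow Y (- p / t)) B))))
               (adj A)).

Definition solves_eq1 {n} (s t p : R) (A B Q Y : Mat n) : Prop :=
  madd (madd (mpow Y (s / t)) (mmul (adj A) (mmul (minv Y) A)))
       (mmul (adj B) (mmul (mpow Y (- p / t)) B)) = Q.

Definition solves_eq2 {n} (s t p : R) (A B Q X : Mat n) : Prop :=
  madd (madd (mpow X s) (mmul (adj A) (mmul (mpow X (- t)) A)))
       (mmul (adj B) (mmul (mpow X (- p)) B)) = Q.

Fixpoint iterXY {n} (s t p : R) (A B Q : Mat n) (a b : R) (k : nat) : Mat n * Mat n :=
  match k with
  | O => (smat a, smat b)
  | S k' => let (X, Y) := iterXY s t p A B Q a b k' in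
            (Fmap s t p A B Q X Y, Fmap s t p A B Q Y X)
  end.

(* Main.v *)
From Stdlib Require Import Reals Lra Lia FunctionalExtensionality ClassicalEpsilon.
From Stdlib Require Fin.
From mathcomp Require Import ssreflect.
From mathcomp Require all_boot all_order all_algebra sesquilinear spectral complex Rstruct.
Require Import Defs.
Open Scope R_scope.
Open Scope general_if_scope.

(** For [X], [Y] in [[aI, bI]] put [M = Q - X^(s/t) - B^* Y^(-p/t) B], so that [F(X, Y) = A M^-1 A^*].
    Hypothesis (ii) gives [b^-1 A^* A <= M <= Q], and since inversion reverses the Loewner order,
    [F] maps [[aI, bI]]^2 into [[aI, bI]]; the bracketing (II) follows in the same way by comparing
    the fixed point with scalar matrices.

    The resolvent identity [M1^-1 - M2^-1 = M1^-1 (M2 - M1) M2^-1] together with [M >= theta I]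
    reduces the contraction estimate to the Lipschitz bounds of [X |-> X^(s/t)] and [Y |-> Y^(-p/t)]
    on [[aI, oo)].  These come from the Loewner-Heinz inequality: [X <= Y + eps I] implies
    [X^r <= (Y + eps I)^r <= Y^r + r a^(r-1) eps I] for [0 <= r <= 1].  Loewner-Heinz itself is
    obtained by showing that the set of admissible exponents contains 0 and 1, is closed, and is
    stable under midpoints.  Conditions (iii) and (iv) give [delta < 1]. *)

(** The constants come from the two ends of the interval. From [M <= Q] one gets [F >= A Q^-1 A^*],
    whose smallest eigenvalue is [a]; putting [b^-1 A^* A] in place of [M] gives exactly [b I]; and
    [theta] is the smallest eigenvalue of that same lower bound of [M]. The obstacle is that [X] and
    [Y] need not commute, so scalar estimates for powers do not transfer to them. Operator
    monotonicity replaces these estimates, and it is here that [s/t] and [p/t] must be at most 1.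
    The negative exponent is reached by inverting the monotonicity inequality. Existence uses only
    the diagonal map [X |-> F(X, X)], a contraction of a closed Loewner interval. The coupled
    sequences are not shown to converge on their own: their distance to its fixed point decays
    geometrically. Since [minv], [mpow], [lmin] and [mnorm] are values picked by [epsilon], each is
    pinned down by a characterisation before use: powers by any diagonalisation, the norm by
    [bounded_by], and the order by pointwise inequalities of quadratic forms. *)

Definition spec {n} (U : Mat n) (d : Fin.t n -> R) : Mat n :=
  mmul U (mmul (diag d) (adj U)).

Lemma mat_ext n (M N : Mat n) : (forall i j, M i j = N i j) -> M = N.
Proof.
by move=> h; apply: functional_extensionality => i; apply: functional_extensionality.
Qed.

(** * Transfer of the spectral theorem to matrices given as functions *)

Module SpectralTransfer.
Import all_boot all_order all_algebra sesquilinear spectral complex Rstruct.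
Import Order.TTheory GRing.Theory Num.Theory.
Local Open Scope ring_scope.
Local Open Scope complex_scope.
Local Open Scope sesquilinear_scope.

(** [unlift ord0] peels off the first index. For [n = 0] the bound carried by [i] is an equation
    [false = true]. *)
Fixpoint fin_of_ord {n} : 'I_n -> Fin.t n :=
  match n with
  | O => fun i => False_rect _ (Bool.diff_false_true (ltn_ord i))
  | S m => fun i => if unlift ord0 i is Some j then Fin.FS (fin_of_ord j) else Fin.F1
  end.

Fixpoint ord_of_fin {n} (i : Fin.t n) : 'I_n :=
  match i with
  | Fin.F1 _ => ord0
  | Fin.FS _ j => lift ord0 (ord_of_fin j)
  end.

(** This direction recovers a matrix after the round trip and makes [ord_of_fin] injective, which
    keeps diagonal matrices diagonal. *)
Lemma ord_of_finK n : cancel (@ord_of_fin n) fin_of_ord.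
Proof.
by elim => [m|m i IH] /=; rewrite ?unlift_none ?liftK ?IH.
Qed.

Definition RC : numClosedFieldType := R[i].

Definition toC (z : C) : R[i] := Cre z +i* Cim z.
Definition ofC (z : R[i]) : C := mkC (complex.Re z) (complex.Im z).

Lemma toCK : cancel toC ofC.
Proof. by case. Qed.

Lemma ofC_add z w : ofC (z + w) = Cadd (ofC z) (ofC w).
Proof. by case: z w => [a b] [c d]. Qed.

Lemma ofC_mul z w : ofC (z * w) = Cmul (ofC z) (ofC w).
Proof. by case: z w => [a b] [c d]. Qed.

Lemma ofC_conj z : ofC z^* = Cconj (ofC z).
Proof. by case: z => [a b]. Qed.

Lemma ofC_sum n (f : 'I_n -> R[i]) :
  ofC (\sum_i f i) = fsum n (fun i => ofC (f (ord_of_fin i))).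
Proof.
elim: n f => [|n IH] f; first by rewrite big_ord0.
by rewrite big_ord_recl ofC_add IH.
Qed.

Definition toM {n} (M : Mat n) : 'M[RC]_n :=
  \matrix_(i, j) toC (M (fin_of_ord i) (fin_of_ord j)).
Definition ofM {n} (M : 'M[RC]_n) : Mat n :=
  fun i j => ofC (M (ord_of_fin i) (ord_of_fin j)).

Lemma toMK n (M : Mat n) : ofM (toM M) = M.
Proof. by apply: mat_ext => i j; rewrite /ofM mxE !ord_of_finK toCK. Qed.

Lemma ofM_mul n (M N : 'M[RC]_n) : ofM (M *m N) = mmul (ofM M) (ofM N).
Proof.
apply: mat_ext => i j; rewrite /ofM mxE ofC_sum /mmul; congr fsum.
by apply: functional_extensionality => k; rewrite ofC_mul.
Qed.

Lemma ofM_adj n (M : 'M[RC]_n) : ofM (M ^t*) = adj (ofM M).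
Proof. by apply: mat_ext => i j; rewrite /ofM !mxE ofC_conj. Qed.

Lemma ofM_diag n (d : 'rV[RC]_n) : d \is a realmx ->
  ofM (diag_mx d) = diag (fun i => Cre (ofC (d 0 (ord_of_fin i)))).
Proof.
move=> /mxOverP dR; apply: mat_ext => i j; rewrite /ofM mxE /diag.
case: (Fin.eq_dec i j) => [->|ne].
  rewrite eqxx mulr1n /RtoC; have := dR 0 (ord_of_fin j).
  by case: (d _ _) => x y; rewrite complex_real /= => /eqP ->.
have /negbTE -> : ord_of_fin i != ord_of_fin j.
  by apply/eqP => /(can_inj (@ord_of_finK n)).
by rewrite mulr0n.
Qed.

Lemma ofM_1 n : ofM (1%:M : 'M[RC]_n) = mI.
Proof.
apply: mat_ext => i j; rewrite /ofM mxE /mI /smat /diag.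
case: (Fin.eq_dec i j) => [->|ne]; first by rewrite eqxx.
have /negbTE -> // : ord_of_fin i != ord_of_fin j.
by apply/eqP => /(can_inj (@ord_of_finK n)).
Qed.

Lemma toM_herm n (M : Mat n) : Defs.hermitian M -> toM M \is hermsymmx.
Proof.
move=> hM; apply/is_hermitianmxP; rewrite expr0 scale1r.
apply/matrixP => i j; rewrite !mxE -[in LHS]hM /adj.
by case: (M _ _).
Qed.

(** A normal matrix is diagonalised in the form [P^-1 D P] with [P] unitary, so the [U] wanted here
    is the conjugate transpose of [P]. Hermitian symmetry makes the entries of [D] real. *)
Lemma spectral_theorem n (M : Mat n) : Defs.hermitian M ->
  exists (U : Mat n) (d : Fin.t n -> R), unitary U /\ M = spec U d.
Proof.
move=> /toM_herm hM.
have Pu := spectral_unitarymx (toM M).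
have := hermitian_normalmx hM => /orthomx_spectralP.
rewrite invmx_unitary //; set P := spectralmx _; set d := spectral_diag _ => eM.
exists (ofM (P ^t*)), (fun i => Cre (ofC (d 0 (ord_of_fin i)))); split.
  rewrite /unitary -ofM_adj -!ofM_mul trmxCK.
  have /unitarymxP -> := Pu.
  have := Pu; rewrite -trmxC_unitary => /unitarymxP; rewrite trmxCK => ->.
  by rewrite ofM_1.
rewrite /spec -ofM_adj -ofM_diag; last exact: hermitian_spectral_diag_real.
by rewrite -!ofM_mul trmxCK mulmxA -eM toMK.
Qed.

End SpectralTransfer.

(** * Matrix algebra and quadratic forms *)

Lemma C_ext (z w : C) : Cre z = Cre w -> Cim z = Cim w -> z = w.
Proof. by case: z w => [a b] [c d] /= -> ->. Qed.

Definition Csub (z w : C) : C := Cadd z (Copp w).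

Lemma C_ring_theory : ring_theory C0 C1 Cadd Cmul Csub Copp eq.
Proof. by constructor; intros; apply: C_ext => /=; ring. Qed.
Add Ring C_ring : C_ring_theory.

Lemma Cconj_add z w : Cconj (Cadd z w) = Cadd (Cconj z) (Cconj w).
Proof. apply: C_ext => /=; ring. Qed.
Lemma Cconj_mul z w : Cconj (Cmul z w) = Cmul (Cconj z) (Cconj w).
Proof. apply: C_ext => /=; ring. Qed.
Lemma Cconj_conj z : Cconj (Cconj z) = z.
Proof. apply: C_ext => /=; ring. Qed.
Lemma Cconj_opp z : Cconj (Copp z) = Copp (Cconj z).
Proof. apply: C_ext => /=; ring. Qed.
Lemma Cconj_RtoC x : Cconj (RtoC x) = RtoC x.
Proof. apply: C_ext => /=; ring. Qed.
Lemma Cconj_0 : Cconj C0 = C0.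
Proof. apply: C_ext => /=; ring. Qed.

Lemma fsum_ext n f g : (forall i, f i = g i) -> fsum n f = fsum n g.
Proof. by move=> h; congr fsum; apply: functional_extensionality. Qed.

Lemma fsum_add n f g : fsum n (fun i => Cadd (f i) (g i)) = Cadd (fsum n f) (fsum n g).
Proof. elim: n f g => [|n IH] f g /=; [ring | rewrite IH; ring]. Qed.

Lemma fsum_opp n f : fsum n (fun i => Copp (f i)) = Copp (fsum n f).
Proof. elim: n f => [|n IH] f /=; [ring | rewrite IH; ring]. Qed.

Lemma fsum_mull n c f : fsum n (fun i => Cmul c (f i)) = Cmul c (fsum n f).
Proof. elim: n f => [|n IH] f /=; [ring | rewrite IH; ring]. Qed.

Lemma fsum_mulr n c f : fsum n (fun i => Cmul (f i) c) = Cmul (fsum n f) c.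
Proof. elim: n f => [|n IH] f /=; [ring | rewrite IH; ring]. Qed.

Lemma fsum_conj n f : fsum n (fun i => Cconj (f i)) = Cconj (fsum n f).
Proof. elim: n f => [|n IH] f /=; [by rewrite Cconj_0 | by rewrite IH Cconj_add]. Qed.

Lemma fsum_0 n : fsum n (fun _ => C0) = C0.
Proof. elim: n => [|n /= ->] //; ring. Qed.

Lemma fsum_swap n m (f : Fin.t n -> Fin.t m -> C) :
  fsum n (fun i => fsum m (f i)) = fsum m (fun j => fsum n (fun i => f i j)).
Proof.
elim: n f => [|n IH] f /=; first by rewrite fsum_0.
by rewrite IH fsum_add.
Qed.

Lemma fsum_delta n i (f : Fin.t n -> C) :
  (forall j, j <> i -> f j = C0) -> fsum n f = f i.
Proof.
elim: i f => [m|m i IH] f h /=.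
  rewrite (fsum_ext _ _ (fun _ => C0)); last by move=> j; apply: h.
  rewrite fsum_0; ring.
rewrite h // (IH (fun j => f (Fin.FS j))); first ring.
by move=> j ne; apply: h => /Fin.FS_inj.
Qed.

Lemma Cre_fsum_le n f g :
  (forall i, Cre (f i) <= Cre (g i)) -> Cre (fsum n f) <= Cre (fsum n g).
Proof.
elim: n f g => [|n IH] f g h /=; first lra.
have := h Fin.F1; have := IH (fun i => f (Fin.FS i)) (fun i => g (Fin.FS i)) (fun i => h _).
lra.
Qed.

Lemma Cre_fsum_ge n f i :
  (forall i, 0 <= Cre (f i)) -> Cre (f i) <= Cre (fsum n f).
Proof.
elim: i f => [m|m i IH] f h /=.
  have := Cre_fsum_le m (fun _ => C0) (fun i => f (Fin.FS i)) (fun i => h _).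
  rewrite fsum_0 /=; lra.
have := IH (fun i => f (Fin.FS i)) (fun i => h _); have := h Fin.F1; lra.
Qed.

Lemma mmul_assoc {n} (M N P : Mat n) : mmul M (mmul N P) = mmul (mmul M N) P.
Proof.
apply: mat_ext => i j; rewrite /mmul.
rewrite (fsum_ext _ _ (fun k => fsum n (fun l => Cmul (Cmul (M i k) (N k l)) (P l j)))).
  by rewrite fsum_swap; apply: fsum_ext => l; rewrite fsum_mulr.
by move=> k; rewrite -fsum_mull; apply: fsum_ext => l; ring.
Qed.

Lemma mmul_diag_l {n} (d : Fin.t n -> R) M i j :
  mmul (diag d) M i j = Cmul (RtoC (d i)) (M i j).
Proof.
rewrite /mmul (fsum_delta n i) /diag.
  by case: Fin.eq_dec.
by move=> k ne; case: Fin.eq_dec => [e|_]; [case: ne | ring].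
Qed.

Lemma mmul_diag_r {n} (d : Fin.t n -> R) M i j :
  mmul M (diag d) i j = Cmul (M i j) (RtoC (d j)).
Proof.
rewrite /mmul (fsum_delta n j) /diag.
  by case: Fin.eq_dec.
by move=> k ne; case: Fin.eq_dec => [e|_]; [case: ne | ring].
Qed.

Lemma RtoC_1 : RtoC 1 = C1.
Proof. by []. Qed.
Lemma RtoC_mul x y : RtoC (x * y) = Cmul (RtoC x) (RtoC y).
Proof. apply: C_ext => /=; ring. Qed.
Lemma RtoC_add x y : RtoC (x + y) = Cadd (RtoC x) (RtoC y).
Proof. apply: C_ext => /=; ring. Qed.

Lemma mmul_1_l {n} (M : Mat n) : mmul mI M = M.
Proof. by apply: mat_ext => i j; rewrite mmul_diag_l RtoC_1; ring. Qed.
Lemma mmul_1_r {n} (M : Mat n) : mmul M mI = M.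
Proof. by apply: mat_ext => i j; rewrite mmul_diag_r RtoC_1; ring. Qed.

Lemma mmul_smat_comm {n} c (M : Mat n) : mmul (smat c) M = mmul M (smat c).
Proof. by apply: mat_ext => i j; rewrite mmul_diag_l mmul_diag_r; ring. Qed.

Lemma mmul_madd_l {n} (M N P : Mat n) : mmul (madd M N) P = madd (mmul M P) (mmul N P).
Proof.
by apply: mat_ext => i j; rewrite /madd /mmul -fsum_add; apply: fsum_ext => k; ring.
Qed.
Lemma mmul_madd_r {n} (M N P : Mat n) : mmul P (madd M N) = madd (mmul P M) (mmul P N).
Proof.
by apply: mat_ext => i j; rewrite /madd /mmul -fsum_add; apply: fsum_ext => k; ring.
Qed.
Lemma mmul_msub_l {n} (M N P : Mat n) : mmul (msub M N) P = msub (mmul M P) (mmul N P).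
Proof.
apply: mat_ext => i j; rewrite /msub /mmul -fsum_opp -fsum_add.
by apply: fsum_ext => k; ring.
Qed.
Lemma mmul_msub_r {n} (M N P : Mat n) : mmul P (msub M N) = msub (mmul P M) (mmul P N).
Proof.
apply: mat_ext => i j; rewrite /msub /mmul -fsum_opp -fsum_add.
by apply: fsum_ext => k; ring.
Qed.

Lemma adj_mmul {n} (M N : Mat n) : adj (mmul M N) = mmul (adj N) (adj M).
Proof.
apply: mat_ext => i j; rewrite /adj /mmul -fsum_conj.
by apply: fsum_ext => k; rewrite Cconj_mul; ring.
Qed.
Lemma adj_adj {n} (M : Mat n) : adj (adj M) = M.
Proof. by apply: mat_ext => i j; rewrite /adj Cconj_conj. Qed.
Lemma adj_msub {n} (M N : Mat n) : adj (msub M N) = msub (adj M) (adj N).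
Proof. by apply: mat_ext => i j; rewrite /adj /msub Cconj_add Cconj_opp. Qed.
Lemma adj_diag {n} (d : Fin.t n -> R) : adj (diag d) = diag d.
Proof.
apply: mat_ext => i j; rewrite /adj /diag.
case: Fin.eq_dec => [->|ne]; case: Fin.eq_dec => [e|ne'] //; rewrite ?Cconj_RtoC ?Cconj_0 //.
by case: ne.
Qed.

Lemma diag_mul {n} (d e : Fin.t n -> R) :
  mmul (diag d) (diag e) = diag (fun i => d i * e i).
Proof.
apply: mat_ext => i j; rewrite mmul_diag_l /diag.
by case: Fin.eq_dec => [->|_]; rewrite ?RtoC_mul //; ring.
Qed.

Lemma diag_add {n} (d e : Fin.t n -> R) :
  madd (diag d) (diag e) = diag (fun i => d i + e i).
Proof.
apply: mat_ext => i j; rewrite /madd /diag.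
by case: Fin.eq_dec => [->|_]; rewrite ?RtoC_add //; ring.
Qed.

Lemma vec_ext {n} (u v : Vec n) : (forall i, u i = v i) -> u = v.
Proof. exact: functional_extensionality. Qed.

Definition vadd {n} (u v : Vec n) : Vec n := fun i => Cadd (u i) (v i).
Definition vscale {n} (c : C) (v : Vec n) : Vec n := fun i => Cmul c (v i).

Lemma mvmul_mmul {n} (M N : Mat n) v : mvmul (mmul M N) v = mvmul M (mvmul N v).
Proof.
apply: vec_ext => i; rewrite /mvmul /mmul.
rewrite (fsum_ext _ _ (fun k => fsum n (fun l => Cmul (Cmul (M i l) (N l k)) (v k)))).
  rewrite fsum_swap; apply: fsum_ext => l; rewrite -fsum_mull.
  by apply: fsum_ext => k; ring.
by move=> k; rewrite fsum_mulr.
Qed.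

Lemma mvmul_madd {n} (M N : Mat n) v : mvmul (madd M N) v = vadd (mvmul M v) (mvmul N v).
Proof.
by apply: vec_ext => i; rewrite /vadd /mvmul -fsum_add; apply: fsum_ext => k; rewrite /madd; ring.
Qed.

Lemma mvmul_vadd {n} (M : Mat n) u v : mvmul M (vadd u v) = vadd (mvmul M u) (mvmul M v).
Proof.
by apply: vec_ext => i; rewrite /vadd /mvmul -fsum_add; apply: fsum_ext => k; ring.
Qed.

Lemma mvmul_vscale {n} (M : Mat n) c v : mvmul M (vscale c v) = vscale c (mvmul M v).
Proof.
by apply: vec_ext => i; rewrite /vscale /mvmul -fsum_mull; apply: fsum_ext => k; ring.
Qed.

Lemma mvmul_diag {n} (d : Fin.t n -> R) v i : mvmul (diag d) v i = Cmul (RtoC (d i)) (v i).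
Proof.
rewrite /mvmul (fsum_delta n i) /diag.
  by case: Fin.eq_dec.
by move=> k ne; case: Fin.eq_dec => [e|_]; [case: ne | ring].
Qed.

Lemma mvmul_smat {n} c (v : Vec n) : mvmul (smat c) v = vscale (RtoC c) v.
Proof. by apply: vec_ext => i; rewrite mvmul_diag. Qed.

Lemma mvmul_1 {n} (v : Vec n) : mvmul mI v = v.
Proof. by apply: vec_ext => i; rewrite mvmul_diag RtoC_1; ring. Qed.

Lemma mvmul_vzero {n} (M : Mat n) : mvmul M vzero = vzero.
Proof.
apply: vec_ext => i; rewrite /mvmul /vzero -[RHS](fsum_0 n).
by apply: fsum_ext => k; ring.
Qed.

Lemma vdot_adj {n} (M : Mat n) u v : vdot u (mvmul M v) = vdot (mvmul (adj M) u) v.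
Proof.
rewrite /vdot /mvmul.
rewrite (fsum_ext _ _ (fun i => fsum n (fun k => Cmul (Cmul (Cconj (u i)) (M i k)) (v k)))).
  rewrite fsum_swap; apply: fsum_ext => k; rewrite -fsum_conj -fsum_mulr.
  by apply: fsum_ext => i; rewrite /adj Cconj_mul Cconj_conj; ring.
by move=> i; rewrite -fsum_mull; apply: fsum_ext => k; ring.
Qed.

Lemma vdot_vadd_r {n} (u v w : Vec n) : vdot u (vadd v w) = Cadd (vdot u v) (vdot u w).
Proof. by rewrite /vdot -fsum_add; apply: fsum_ext => k; rewrite /vadd; ring. Qed.
Lemma vdot_vadd_l {n} (u v w : Vec n) : vdot (vadd v w) u = Cadd (vdot v u) (vdot w u).
Proof.
by rewrite /vdot -fsum_add; apply: fsum_ext => k; rewrite /vadd Cconj_add; ring.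
Qed.
Lemma vdot_vscale_r {n} c (u v : Vec n) : vdot u (vscale c v) = Cmul c (vdot u v).
Proof. by rewrite /vdot -fsum_mull; apply: fsum_ext => k; rewrite /vscale; ring. Qed.
Lemma vdot_vscale_l {n} c (u v : Vec n) : vdot (vscale c u) v = Cmul (Cconj c) (vdot u v).
Proof.
by rewrite /vdot -fsum_mull; apply: fsum_ext => k; rewrite /vscale Cconj_mul; ring.
Qed.
Lemma vdot_conj {n} (u v : Vec n) : vdot v u = Cconj (vdot u v).
Proof.
by rewrite /vdot -fsum_conj; apply: fsum_ext => k; rewrite Cconj_mul Cconj_conj; ring.
Qed.

Definition nsq {n} (v : Vec n) : R := Cre (vdot v v).
(** For Hermitian [M] the value is already real, so nothing is lost by [Cre]. Comparing these values
    at every [v] is the working form of the Loewner order. *)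
Definition qform {n} (M : Mat n) (v : Vec n) : R := Cre (vdot v (mvmul M v)).

Lemma Cre_conj_mul z : Cre (Cmul (Cconj z) z) = Cre z ^ 2 + Cim z ^ 2.
Proof. case: z => a b /=; ring. Qed.

Lemma nsq_ge {n} (v : Vec n) i : Cre (v i) ^ 2 + Cim (v i) ^ 2 <= nsq v.
Proof.
rewrite -Cre_conj_mul; apply: (Cre_fsum_ge n (fun i => Cmul (Cconj (v i)) (v i)) i) => j.
rewrite Cre_conj_mul; nra.
Qed.

Lemma nsq_ge0 {n} (v : Vec n) : 0 <= nsq v.
Proof.
rewrite -[0]/(Cre C0) -(fsum_0 n); apply: Cre_fsum_le => i.
rewrite Cre_conj_mul /=; nra.
Qed.

Lemma nsq_vzero {n} : nsq (@vzero n) = 0.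
Proof.
rewrite /nsq /vdot (fsum_ext _ _ (fun _ => C0)) ?fsum_0 // => i; rewrite /vzero; ring.
Qed.

Lemma nsq_eq0 {n} (v : Vec n) : nsq v <= 0 -> v = vzero.
Proof.
move=> h; apply: vec_ext => i; have := nsq_ge v i => h'.
apply: C_ext => /=; nra.
Qed.

Lemma nsq_gt0 {n} (v : Vec n) : v <> vzero -> 0 < nsq v.
Proof.
move=> h; case: (Rle_lt_dec (nsq v) 0) => // h'; case: h; exact: nsq_eq0.
Qed.

Lemma nsq_vscale {n} c (v : Vec n) : nsq (vscale (RtoC c) v) = c ^ 2 * nsq v.
Proof.
rewrite /nsq vdot_vscale_l vdot_vscale_r Cconj_RtoC /=; ring.
Qed.

Lemma nsq_vadd {n} (u v : Vec n) : nsq (vadd u v) = nsq u + 2 * Cre (vdot u v) + nsq v.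
Proof.
rewrite /nsq !vdot_vadd_l !vdot_vadd_r (vdot_conj u v) /=; ring.
Qed.

(** The vector [|v|^2 u - Re<u,v> v] has squared norm [|v|^2 (|u|^2 |v|^2 - (Re<u,v>)^2)], which is
    nonnegative. Dividing by [|v|^2] leaves only the case [v = 0]. *)
Lemma Cauchy_Schwarz {n} (u v : Vec n) : Cre (vdot u v) ^ 2 <= nsq u * nsq v.
Proof.
have := nsq_ge0 (vadd (vscale (RtoC (nsq v)) u) (vscale (RtoC (- Cre (vdot u v))) v)).
rewrite nsq_vadd !nsq_vscale vdot_vscale_l vdot_vscale_r Cconj_RtoC.
set x := vdot u v; have -> : Cre (Cmul (RtoC (nsq v)) (Cmul (RtoC (- Cre x)) x)) = - (nsq v * Cre x ^ 2).
  by rewrite /=; ring.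
case: (Rle_lt_dec (nsq v) 0) => [h _|]; last by nra.
have v0 := nsq_eq0 _ h; rewrite /x v0 nsq_vzero -[vzero](mvmul_vzero mI).
rewrite {1}/vdot (fsum_ext _ _ (fun _ => C0)) ?fsum_0 /=; first lra.
move=> i; rewrite mvmul_vzero /vzero; ring.
Qed.

Lemma Cauchy_Schwarz_le {n} (u v : Vec n) x y :
  0 <= x -> 0 <= y -> nsq u <= x ^ 2 -> nsq v <= y ^ 2 -> Rabs (Cre (vdot u v)) <= x * y.
Proof.
move=> x0 y0 hu hv; have h := Cauchy_Schwarz u v.
have h2 : nsq u * nsq v <= x ^ 2 * y ^ 2.
  by apply: Rmult_le_compat => //; apply: nsq_ge0.
apply: Rsqr_incr_0_var; last nra.
rewrite -Rsqr_abs /Rsqr; nra.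
Qed.

Lemma qform_madd {n} (M N : Mat n) v : qform (madd M N) v = qform M v + qform N v.
Proof. by rewrite /qform mvmul_madd vdot_vadd_r. Qed.

Lemma msub_madd {n} (M N : Mat n) : madd (msub M N) N = M.
Proof. by apply: mat_ext => i j; rewrite /madd /msub; ring. Qed.

Lemma qform_msub {n} (M N : Mat n) v : qform (msub M N) v = qform M v - qform N v.
Proof. rewrite -{2}(msub_madd M N) qform_madd; ring. Qed.

Lemma qform_smat {n} c (v : Vec n) : qform (smat c) v = c * nsq v.
Proof. rewrite /qform mvmul_smat vdot_vscale_r /nsq /=; ring. Qed.

Lemma qform_smat_mul {n} c (M : Mat n) (v : Vec n) : qform (mmul (smat c) M) v = c * qform M v.
Proof. rewrite /qform mvmul_mmul mvmul_smat vdot_vscale_r /=; ring. Qed.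

Lemma qform_congr {n} (S M : Mat n) v :
  qform (mmul (adj S) (mmul M S)) v = qform M (mvmul S v).
Proof. by rewrite /qform !mvmul_mmul vdot_adj adj_adj. Qed.

Lemma qform_gram {n} (S : Mat n) v : qform (mmul (adj S) S) v = nsq (mvmul S v).
Proof. by rewrite /qform mvmul_mmul vdot_adj adj_adj. Qed.

Lemma qform_diag_le {n} (d e : Fin.t n -> R) v :
  (forall i, d i <= e i) -> qform (diag d) v <= qform (diag e) v.
Proof.
move=> h; apply: Cre_fsum_le => i; rewrite !mvmul_diag /=; have := h i; nra.
Qed.

Lemma herm_diag {n} (d : Fin.t n -> R) : hermitian (diag d).
Proof. exact: adj_diag. Qed.
Lemma herm_msub {n} (M N : Mat n) : hermitian M -> hermitian N -> hermitian (msub M N).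
Proof. by rewrite /hermitian adj_msub => -> ->. Qed.
Lemma herm_congr {n} (S M : Mat n) : hermitian M -> hermitian (mmul (adj S) (mmul M S)).
Proof. by rewrite /hermitian !adj_mmul adj_adj mmul_assoc => ->. Qed.
Lemma herm_congr' {n} (S M : Mat n) : hermitian M -> hermitian (mmul S (mmul M (adj S))).
Proof. by move/(herm_congr (adj S)); rewrite adj_adj. Qed.
Lemma herm_gram {n} (S : Mat n) : hermitian (mmul (adj S) S).
Proof. by rewrite /hermitian !adj_mmul adj_adj. Qed.

Lemma mle_qform {n} (M N : Mat n) : mle M N -> forall v, qform M v <= qform N v.
Proof. move=> [_ h] v; have := h v; rewrite -/(qform _ v) qform_msub; lra. Qed.

Lemma qform_mle {n} (M N : Mat n) : hermitian M -> hermitian N ->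
  (forall v, qform M v <= qform N v) -> mle M N.
Proof.
move=> hM hN h; split; first exact: herm_msub.
move=> v; rewrite -/(qform _ v) qform_msub; have := h v; lra.
Qed.

Lemma herm_interval {n} (M N X : Mat n) : in_interval M N X -> hermitian X.
Proof. by case. Qed.

Lemma pd_lower {n} c (M : Mat n) : 0 < c -> hermitian M ->
  (forall v, c * nsq v <= qform M v) -> pd M.
Proof.
move=> c0 hM h; split=> // v /nsq_gt0 v0; apply: Rlt_le_trans (h v); nra.
Qed.

(** * Spectral calculus *)

Lemma unitary_KV {n} (U M : Mat n) : unitary U -> mmul (adj U) (mmul U M) = M.
Proof. by move=> [h _]; rewrite mmul_assoc h mmul_1_l. Qed.

Lemma nsq_unitary {n} (U : Mat n) v : unitary U -> nsq (mvmul U v) = nsq v.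
Proof. by move=> [h _]; rewrite -qform_gram h qform_smat Rmult_1_l. Qed.

Lemma spec_mul {n} (U : Mat n) d e : unitary U ->
  mmul (spec U d) (spec U e) = spec U (fun i => d i * e i).
Proof.
by move=> hU; rewrite /spec -!mmul_assoc unitary_KV // -diag_mul -!mmul_assoc.
Qed.

Lemma spec_madd {n} (U : Mat n) d e :
  madd (spec U d) (spec U e) = spec U (fun i => d i + e i).
Proof. by rewrite /spec -diag_add mmul_madd_l mmul_madd_r. Qed.

(** A scalar matrix is diagonal in every unitary frame. This turns bounds by [c I] into bounds on
    eigenvalues and keeps a shift by [c I] inside the same frame. *)
Lemma spec_smat {n} (U : Mat n) c : unitary U -> spec U (fun _ => c) = smat c.
Proof.
by move=> [_ h]; rewrite /spec -/(smat c) mmul_smat_comm mmul_assoc h mmul_1_l.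
Qed.

Lemma spec_ext {n} (U : Mat n) d e : (forall i, d i = e i) -> spec U d = spec U e.
Proof. by move=> h; congr spec; apply: functional_extensionality. Qed.

Lemma herm_spec {n} (U : Mat n) d : hermitian (spec U d).
Proof. exact/herm_congr'/herm_diag. Qed.

Lemma qform_spec {n} (U : Mat n) d v : qform (spec U d) v = qform (diag d) (mvmul (adj U) v).
Proof. by rewrite /spec -{1}(adj_adj U) qform_congr. Qed.

Lemma qform_spec_le {n} (U : Mat n) d e v :
  (forall i, d i <= e i) -> qform (spec U d) v <= qform (spec U e) v.
Proof. by move=> h; rewrite !qform_spec; apply: qform_diag_le. Qed.

Lemma qform_spec_ge {n} (U : Mat n) d c v : unitary U ->
  (forall i, c <= d i) -> c * nsq v <= qform (spec U d) v.
Proof.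
by move=> hU h; rewrite -qform_smat -(spec_smat U) //; apply: qform_spec_le.
Qed.

Lemma qform_spec_upper {n} (U : Mat n) d c v : unitary U ->
  (forall i, d i <= c) -> qform (spec U d) v <= c * nsq v.
Proof.
by move=> hU h; rewrite -qform_smat -(spec_smat U) //; apply: qform_spec_le.
Qed.

Definition basis_vec {n} (i : Fin.t n) : Vec n :=
  fun j => if Fin.eq_dec i j then C1 else C0.

Lemma mvmul_basis {n} (M : Mat n) i j : mvmul M (basis_vec j) i = M i j.
Proof.
rewrite /mvmul (fsum_delta n j) /basis_vec.
  by case: Fin.eq_dec => // _; ring.
by move=> k ne; case: Fin.eq_dec => [e|_]; [case: ne | ring].
Qed.

Lemma vdot_basis {n} (i : Fin.t n) v : vdot (basis_vec i) v = v i.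
Proof.
rewrite /vdot (fsum_delta n i) /basis_vec.
  by case: Fin.eq_dec => // _; apply: C_ext => /=; ring.
move=> k ne; case: Fin.eq_dec => [e|_]; [by case: ne | rewrite Cconj_0; ring].
Qed.

Lemma nsq_basis {n} (i : Fin.t n) : nsq (basis_vec i) = 1.
Proof. by rewrite /nsq vdot_basis /basis_vec; case: Fin.eq_dec. Qed.

Definition eigvec {n} (U : Mat n) (i : Fin.t n) : Vec n := mvmul U (basis_vec i).

Lemma nsq_eigvec {n} (U : Mat n) i : unitary U -> nsq (eigvec U i) = 1.
Proof. by move=> hU; rewrite nsq_unitary // nsq_basis. Qed.

Lemma eigvec_neq0 {n} (U : Mat n) i : unitary U -> eigvec U i <> vzero.
Proof. move=> /(nsq_eigvec _ i) h e; move: h; rewrite e nsq_vzero; lra. Qed.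

Lemma mvmul_spec_eigvec {n} (U : Mat n) d i : unitary U ->
  mvmul (spec U d) (eigvec U i) = vscale (RtoC (d i)) (eigvec U i).
Proof.
move=> [h _]; rewrite /spec /eigvec !mvmul_mmul -(mvmul_mmul (adj U)) h mvmul_1 -mvmul_vscale.
congr mvmul; apply: vec_ext => j; rewrite mvmul_diag /vscale /basis_vec.
by case: Fin.eq_dec => [->|_] //; ring.
Qed.

Lemma qform_spec_eigvec {n} (U : Mat n) d i : unitary U ->
  qform (spec U d) (eigvec U i) = d i.
Proof.
move=> hU; rewrite /qform mvmul_spec_eigvec // vdot_vscale_r.
have := nsq_eigvec U i hU; rewrite /nsq /= => ->; ring.
Qed.

Lemma spec_lower {n} (U : Mat n) d c : unitary U ->
  (forall v, c * nsq v <= qform (spec U d) v) -> forall i, c <= d i.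
Proof.
move=> hU h i; have := h (eigvec U i); rewrite nsq_eigvec // qform_spec_eigvec //; lra.
Qed.

Lemma spec_upper {n} (U : Mat n) d c : unitary U ->
  (forall v, qform (spec U d) v <= c * nsq v) -> forall i, d i <= c.
Proof.
move=> hU h i; have := h (eigvec U i); rewrite nsq_eigvec // qform_spec_eigvec //; lra.
Qed.

Lemma Fin_argmin {n} (d : Fin.t n -> R) : (1 <= n)%nat -> exists i, forall j, d i <= d j.
Proof.
elim: n d => [|n IH] d; first lia.
move=> _; case: n IH d => [|n] IH d.
  exists Fin.F1 => j; pattern j; apply: Fin.caseS' => [|i]; [lra | by apply: (Fin.case0 (fun _ => _) i)].
have [|i hi] := IH (fun j => d (Fin.FS j)); first lia.
case: (Rle_lt_dec (d Fin.F1) (d (Fin.FS i))) => h.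
  exists Fin.F1 => j; pattern j; apply: Fin.caseS' => [|k]; [lra | have := hi k; lra].
exists (Fin.FS i) => j; pattern j; apply: Fin.caseS' => [|k]; [lra | exact: hi].
Qed.

Lemma Fin_lower {n} (d : Fin.t n -> R) : (forall i, 0 < d i) ->
  exists c, 0 < c /\ forall i, c <= d i.
Proof.
(* Without indices any positive constant serves; 1 is a default. *)
case: n d => [|n] d d0; first by exists 1; split; [lra | move=> i; apply: (Fin.case0 (fun _ => _) i)].
have [|i hi] := Fin_argmin d; first lia.
by exists (d i).
Qed.

Lemma pd_spec {n} (U : Mat n) d : unitary U -> (forall i, 0 < d i) -> pd (spec U d).
Proof.
move=> hU /Fin_lower [c [c0 h]]; apply: (pd_lower c) => //; first exact: herm_spec.
by move=> v; apply: qform_spec_ge.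
Qed.

Lemma pd_spectral {n} (M : Mat n) : pd M ->
  exists U d, unitary U /\ (forall i, 0 < d i) /\ M = spec U d.
Proof.
move=> [hM h]; have [U [d [hU e]]] := SpectralTransfer.spectral_theorem _ _ hM.
exists U, d; split=> //; split=> // i.
have := h _ (eigvec_neq0 U i hU); rewrite -/(qform M _) e qform_spec_eigvec //.
Qed.

Lemma lower_spectral {n} (M : Mat n) c : hermitian M -> (forall v, c * nsq v <= qform M v) ->
  exists U d, unitary U /\ (forall i, c <= d i) /\ M = spec U d.
Proof.
move=> hM h; have [U [d [hU e]]] := SpectralTransfer.spectral_theorem _ _ hM.
by exists U, d; split=> //; split=> //; apply: (spec_lower U) => //; rewrite -e.
Qed.

(** [epsilon] promises only some two-sided inverse; uniqueness of inverses identifies it with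
    [N]. *)
Lemma minv_unique {n} (M N : Mat n) : mmul M N = mI -> mmul N M = mI -> minv M = N.
Proof.
move=> h1 h2.
have [_ e2] : mmul M (minv M) = mI /\ mmul (minv M) M = mI.
  by apply: (epsilon_spec (inhabits M) (fun N => mmul M N = mI /\ mmul N M = mI)); exists N.
by rewrite -(mmul_1_r (minv M)) -h1 mmul_assoc e2 mmul_1_l.
Qed.

Lemma minv_invertible {n} (M : Mat n) : invertible M ->
  mmul M (minv M) = mI /\ mmul (minv M) M = mI.
Proof. by move=> [N [h1 h2]]; rewrite (minv_unique _ _ h1 h2). Qed.

(* The intertwiner [V^* U] between two diagonalisations vanishes off equal eigenvalues. *)
Lemma spec_map {n} (f : R -> R) (U V : Mat n) d e : unitary U -> unitary V ->
  spec U d = spec V e -> spec U (fun i => f (d i)) = spec V (fun i => f (e i)).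
Proof.
move=> hU hV; rewrite /spec => h.
have hW : mmul (mmul (adj V) U) (diag d) = mmul (diag e) (mmul (adj V) U).
  have := f_equal (fun M => mmul (adj V) (mmul M U)) h.
  case: hU => hU _.
  by rewrite -!mmul_assoc hU mmul_1_r unitary_KV.
have {}hW : mmul (mmul (adj V) U) (diag (fun i => f (d i)))
          = mmul (diag (fun i => f (e i))) (mmul (adj V) U).
  apply: mat_ext => i j; have := f_equal (fun M => M i j) hW => /=.
  rewrite !mmul_diag_l !mmul_diag_r.
  case: (Req_dec (d j) (e i)) => [->|ne]; first by move=> _; ring.
  set w := mmul _ _ i j => hw.
  have -> : w = C0.
    have h0 := f_equal Cre hw; have h1 := f_equal Cim hw; move: h0 h1 => /= h0 h1.
    apply: C_ext => /=; apply: (Rmult_eq_reg_r (d j - e i)); lra.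
  by ring.
have := f_equal (fun M => mmul V (mmul M (adj U))) hW.
case: hV => _ hV; case: hU => _ hU.
by rewrite -!mmul_assoc hU mmul_1_r mmul_assoc hV mmul_1_l.
Qed.

(** The matrix picked by [epsilon] comes from an unknown diagonalisation; [spec_map] shows that the
    given one yields the same power. *)
Lemma mpow_spec {n} (U : Mat n) d r : unitary U -> (forall i, 0 < d i) ->
  mpow (spec U d) r = spec U (fun i => Rpower (d i) r).
Proof.
move=> hU d0.
have [V [e [hV [e0 [h1 h2]]]]] := epsilon_spec (inhabits (spec U d)) (fun Y => exists V e,
    unitary V /\ (forall i, 0 < e i) /\ spec U d = mmul V (mmul (diag e) (adj V)) /\
    Y = mmul V (mmul (diag (fun i => Rpower (e i) r)) (adj V)))
  (ex_intro _ _ (ex_intro _ U (ex_intro _ d (conj hU (conj d0 (conj eq_refl eq_refl)))))).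
rewrite /mpow h2; symmetry.
exact: (spec_map (fun x => Rpower x r)).
Qed.

Lemma Rpower_pos x r : 0 < Rpower x r.
Proof. exact: exp_pos. Qed.

Lemma pd_mpow {n} (X : Mat n) r : pd X -> pd (mpow X r).
Proof.
move=> /pd_spectral [U [d [hU [d0 ->]]]]; rewrite mpow_spec //; apply: pd_spec => // i.
exact: Rpower_pos.
Qed.

Lemma mpow_mpow {n} (X : Mat n) r r' : pd X -> mpow (mpow X r) r' = mpow X (r * r').
Proof.
move=> /pd_spectral [U [d [hU [d0 ->]]]]; rewrite !mpow_spec //; last by move=> i; apply: Rpower_pos.
by apply: spec_ext => i; rewrite Rpower_mult.
Qed.

Lemma mpow_add {n} (X : Mat n) r r' : pd X -> mmul (mpow X r) (mpow X r') = mpow X (r + r').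
Proof.
move=> /pd_spectral [U [d [hU [d0 ->]]]]; rewrite !mpow_spec // spec_mul //.
by apply: spec_ext => i; rewrite Rpower_plus.
Qed.

Lemma mpow_1 {n} (X : Mat n) : pd X -> mpow X 1 = X.
Proof.
move=> /pd_spectral [U [d [hU [d0 ->]]]]; rewrite !mpow_spec //.
by apply: spec_ext => i; rewrite Rpower_1.
Qed.

Lemma mpow_0 {n} (X : Mat n) : pd X -> mpow X 0 = mI.
Proof.
move=> /pd_spectral [U [d [hU [d0 ->]]]]; rewrite !mpow_spec // /mI -(spec_smat U) //.
by apply: spec_ext => i; rewrite Rpower_O.
Qed.

Lemma mpow_smat {n} c r : 0 < c -> mpow (@smat n c) r = smat (Rpower c r).
Proof.
move=> c0; have hI : unitary (@mI n) by split; rewrite /mI /smat adj_diag mmul_1_l.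
by rewrite -!(spec_smat mI) // mpow_spec.
Qed.

Lemma mpow_opp1 {n} (X : Mat n) : pd X ->
  mmul X (mpow X (-1)) = mI /\ mmul (mpow X (-1)) X = mI.
Proof.
move=> hX; rewrite -{1 4}(mpow_1 X) // !mpow_add // -(mpow_0 X) //.
by split; congr mpow; ring.
Qed.

Lemma minv_mpow {n} (X : Mat n) : pd X -> minv X = mpow X (-1).
Proof. by move=> /mpow_opp1 [h1 h2]; apply: minv_unique. Qed.

Lemma pd_invertible {n} (X : Mat n) : pd X -> invertible X.
Proof. by move=> /mpow_opp1 h; exists (mpow X (-1)). Qed.

Lemma pd_minv {n} (X : Mat n) : pd X -> pd (minv X).
Proof. by move=> hX; rewrite minv_mpow //; apply: pd_mpow. Qed.

Lemma pd_interval {n} a b (X : Mat n) : 0 < a -> in_interval (smat a) (smat b) X -> pd X.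
Proof.
move=> a0 [hX [/mle_qform h _]]; apply: (pd_lower a) => // v; rewrite -qform_smat; exact: h.
Qed.

Lemma Rpower_le_neg x y r : 0 < x -> x <= y -> r <= 0 -> Rpower y r <= Rpower x r.
Proof.
move=> x0 xy r0; rewrite -(Ropp_involutive r) !(Rpower_Ropp _ (- r)).
apply: Rinv_le_contravar; first exact: Rpower_pos.
apply: Rle_Rpower_l; lra.
Qed.

Lemma interval_spectral {n} a b (X : Mat n) : in_interval (smat a) (smat b) X ->
  exists U d, unitary U /\ (forall i, a <= d i <= b) /\ X = spec U d.
Proof.
move=> [hX [/mle_qform h1 /mle_qform h2]].
have [v|U [d [hU [hd e]]]] := lower_spectral X a hX; first by rewrite -qform_smat.
exists U, d; split=> //; split=> // i; split=> //.
by apply: (spec_upper U) => // v; rewrite -e -qform_smat.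
Qed.

Lemma in_interval_spec {n} a b (U : Mat n) d : unitary U -> (forall i, a <= d i <= b) ->
  in_interval (smat a) (smat b) (spec U d).
Proof.
move=> hU hd; split; first exact: herm_spec.
by split; (apply: qform_mle; [exact: herm_spec || exact: herm_diag | exact: herm_spec || exact: herm_diag | move=> v; rewrite qform_smat]);
  [apply: qform_spec_ge | apply: qform_spec_upper] => // i; case: (hd i).
Qed.

(** Scalar endpoints commute with [X], so monotonicity of the scalar power on the spectrum is
    enough, and [r] may exceed 1, unlike in the Loewner-Heinz inequality. *)
Lemma mpow_interval {n} a b r (X : Mat n) : 0 < a -> 0 <= r ->
  in_interval (smat a) (smat b) X ->
  in_interval (smat (Rpower a r)) (smat (Rpower b r)) (mpow X r).
Proof.
move=> a0 r0 /interval_spectral [U [d [hU [hd ->]]]].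
rewrite mpow_spec //; last by move=> i; have := hd i; lra.
by apply: in_interval_spec => // i; have := hd i => ?; split; apply: Rle_Rpower_l; lra.
Qed.

Lemma mpow_interval_neg {n} a b r (X : Mat n) : 0 < a -> r <= 0 ->
  in_interval (smat a) (smat b) X ->
  in_interval (smat (Rpower b r)) (smat (Rpower a r)) (mpow X r).
Proof.
move=> a0 r0 /interval_spectral [U [d [hU [hd ->]]]].
rewrite mpow_spec //; last by move=> i; have := hd i; lra.
by apply: in_interval_spec => // i; have := hd i => ?; split; apply: Rpower_le_neg; lra.
Qed.

(* [<v, X^-1 v>] is the maximum over [w] of [2 Re <w, v> - <w, X w>]. *)
Lemma minv_antitone {n} (X Y : Mat n) : pd X -> pd Y ->
  (forall v, qform X v <= qform Y v) -> forall v, qform (minv Y) v <= qform (minv X) v.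
Proof.
move=> hX hY h v.
have [X1 X2] := minv_invertible _ (pd_invertible _ hX).
have [Y1 Y2] := minv_invertible _ (pd_invertible _ hY).
have hXi : adj (minv X) = minv X := proj1 (pd_minv _ hX).
set w := mvmul (minv Y) v; set u := mvmul (minv X) v.
have eY : mvmul Y w = v by rewrite -mvmul_mmul Y1 mvmul_1.
have eX : mvmul X u = v by rewrite -mvmul_mmul X1 mvmul_1.
have h0 : 0 <= qform X (vadd u (vscale (RtoC (-1)) w)).
  case: (classic (vadd u (vscale (RtoC (-1)) w) = vzero)) => [->|ne].
    rewrite /qform mvmul_vzero -/(nsq vzero) nsq_vzero; lra.
  by apply/Rlt_le/(proj2 hX).
have e1 : qform (minv Y) v = qform Y w.
  by rewrite /qform eY -/w (vdot_conj v w).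
have e2 : qform (minv X) v = Cre (vdot u v) by rewrite /qform -/u (vdot_conj u v).
have e3 : Cre (vdot u (mvmul X w)) = qform (minv Y) v.
  by rewrite vdot_adj (proj1 hX) eX.
have e4 : Cre (vdot w v) = qform Y w by rewrite /qform eY.
have hw := h w; move: h0; rewrite {1}/qform mvmul_vadd mvmul_vscale eX.
rewrite !vdot_vadd_l !vdot_vadd_r !vdot_vscale_l !vdot_vscale_r /= e2 e3 e4.
rewrite -/(qform X w); lra.
Qed.

(** * Norms and the Loewner-Heinz inequality *)

Lemma Rabs_le_inv x y : Rabs x <= y -> - y <= x <= y.
Proof. have := Rle_abs x; have := Rle_abs (- x); rewrite Rabs_Ropp; lra. Qed.

Lemma eigval_qform {n} (M : Mat n) l : is_eigval M l ->
  exists v, 0 < nsq v /\ qform M v = l * nsq v.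
Proof.
move=> [v [v0 e]]; exists v; split; first exact: nsq_gt0.
by rewrite /qform e -/(vscale (RtoC l) v) vdot_vscale_r /nsq /=; ring.
Qed.

(** The least entry of a diagonalisation is attained at an eigenvector and bounds the quadratic form
    below, hence bounds every other eigenvalue too. This also supplies the existence that [epsilon]
    requires. *)
Lemma lmin_spec {n} (M : Mat n) : (1 <= n)%nat -> hermitian M ->
  is_eigval M (lmin M) /\ forall v, lmin M * nsq v <= qform M v.
Proof.
move=> n1 hM; have [U [d [hU e]]] := SpectralTransfer.spectral_theorem _ _ hM.
have [i hi] := Fin_argmin d n1.
have low v : d i * nsq v <= qform M v by rewrite e; apply: qform_spec_ge.
have eig : is_eigval M (d i).
  exists (eigvec U i); split; first exact: eigvec_neq0.
  by rewrite e mvmul_spec_eigvec.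
have eig_ge m : is_eigval M m -> d i <= m.
  by move=> /eigval_qform [v [v0 ev]]; have := low v; rewrite ev => h; nra.
have [h1 h2] := epsilon_spec (inhabits 0)
  (fun l => is_eigval M l /\ forall m, is_eigval M m -> l <= m)
  (ex_intro _ _ (conj eig eig_ge)).
have -> : lmin M = d i by apply: Rle_antisym; [apply: h2 | apply: eig_ge].
by [].
Qed.

Lemma lmin_pos {n} (M : Mat n) : (1 <= n)%nat -> pd M -> 0 < lmin M.
Proof.
move=> n1 hM; have [[v [v0 e]] _] := lmin_spec _ n1 (proj1 hM).
have := proj2 hM v v0; rewrite e -/(vscale (RtoC (lmin M)) v) vdot_vscale_r /=.
have := nsq_gt0 _ v0; rewrite /nsq => h; nra.
Qed.

(** An operator norm bound in squared form: it composes under products, sums and adjoints without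
    suprema, and for [n >= 1] the least such [c] is [mnorm M]. *)
Definition bounded_by {n} (M : Mat n) (c : R) : Prop :=
  0 <= c /\ forall v, nsq (mvmul M v) <= c ^ 2 * nsq v.

Lemma bounded_by_ex {n} (M : Mat n) : (1 <= n)%nat -> exists c, bounded_by M c.
Proof.
move=> n1; have [U [d [hU e]]] := SpectralTransfer.spectral_theorem _ _ (herm_gram M).
(* The minimum of [- d] locates the largest eigenvalue of [M^* M]. *)
have [i hi] := Fin_argmin (fun i => - d i) n1.
(* The square of [1 + |x|] dominates [x], which avoids a square root. *)
exists (1 + Rabs (d i)); split; first by have := Rabs_pos (d i); lra.
move=> v; rewrite -qform_gram e; apply: qform_spec_upper => // j.
have := hi j; have := Rle_abs (d i); have := Rabs_pos (d i); nra.
Qed.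

Lemma vnorm_sqr {n} (v : Vec n) : vnorm v ^ 2 = nsq v.
Proof. by rewrite /vnorm pow2_sqrt //; apply: nsq_ge0. Qed.

Lemma vnorm_le {n} (v : Vec n) c : 0 <= c -> nsq v <= c ^ 2 -> vnorm v <= c.
Proof.
move=> c0 h; rewrite -(sqrt_pow2 c) //; exact: sqrt_le_1_alt.
Qed.

(** The supremum exists because the set is bounded and, for [n >= 1], contains the value at a basis
    vector. *)
Lemma mnorm_lub {n} (M : Mat n) : (1 <= n)%nat ->
  is_lub (fun x => exists v : Vec n, vnorm v = 1 /\ x = vnorm (mvmul M v)) (mnorm M).
Proof.
move=> n1; apply: (epsilon_spec (inhabits 0) (fun c => is_lub _ c)).
have [c [c0 hc]] := bounded_by_ex M n1.
have [|| l hl] := completeness (fun x => exists v : Vec n, vnorm v = 1 /\ x = vnorm (mvmul M v)).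
- exists c => x [v [v1 ->]]; apply: vnorm_le => //.
  by have := hc v; rewrite -vnorm_sqr -(vnorm_sqr v) v1; lra.
- have [i _] := Fin_argmin (fun _ : Fin.t n => 0) n1.
  exists (vnorm (mvmul M (basis_vec i))), (basis_vec i); split=> //.
  by rewrite /vnorm -/(nsq (basis_vec i)) nsq_basis sqrt_1.
by exists l.
Qed.

Lemma mnorm_bound {n} (M : Mat n) : (1 <= n)%nat -> bounded_by M (mnorm M).
Proof.
move=> n1; have [hub _] := mnorm_lub M n1.
have [i _] := Fin_argmin (fun _ : Fin.t n => 0) n1.
split.
  apply: Rle_trans (hub (vnorm (mvmul M (basis_vec i))) _); first exact: sqrt_pos.
  by exists (basis_vec i); rewrite {1}/vnorm -/(nsq (basis_vec i)) nsq_basis sqrt_1.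
move=> v; case: (classic (v = vzero)) => [->|/nsq_gt0 v0].
  rewrite mvmul_vzero nsq_vzero; lra.
set s := sqrt (nsq v); have s0 : 0 < s by apply: sqrt_lt_R0.
have ss : s ^ 2 = nsq v by rewrite /s pow2_sqrt //; lra.
set w := vscale (RtoC (/ s)) v.
have nw : vnorm w = 1.
  rewrite /vnorm -/(nsq w) /w nsq_vscale -ss (_ : _ * _ = 1) ?sqrt_1 //; field; lra.
have := hub _ (ex_intro _ w (conj nw eq_refl)).
move=> /(fun h => pow_incr _ _ 2 (conj (sqrt_pos _) h)).
rewrite vnorm_sqr /w mvmul_vscale nsq_vscale -ss => h.
have -> : nsq (mvmul M v) = ((/ s) ^ 2 * nsq (mvmul M v)) * s ^ 2 by field; lra.
by apply: Rmult_le_compat_r => //; nra.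
Qed.

Lemma mnorm_ge0 {n} (M : Mat n) : (1 <= n)%nat -> 0 <= mnorm M.
Proof. by move=> /(mnorm_bound M) []. Qed.

Lemma mnorm_le {n} (M : Mat n) c : (1 <= n)%nat -> bounded_by M c -> mnorm M <= c.
Proof.
move=> n1 [c0 hc]; apply: (proj2 (mnorm_lub M n1)) => x [v [v1 ->]].
apply: vnorm_le => //; have := hc v; rewrite -(vnorm_sqr v) v1; lra.
Qed.

Lemma bounded_by_mmul {n} (M N : Mat n) c e :
  bounded_by M c -> bounded_by N e -> bounded_by (mmul M N) (c * e).
Proof.
move=> [c0 hc] [e0 he]; split; first nra.
move=> v; rewrite mvmul_mmul; have := hc (mvmul N v); have := he v => h1 h2.
have : c ^ 2 * nsq (mvmul N v) <= c ^ 2 * (e ^ 2 * nsq v) by apply: Rmult_le_compat_l => //; nra.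
nra.
Qed.

Lemma bounded_by_madd {n} (M N : Mat n) c e :
  bounded_by M c -> bounded_by N e -> bounded_by (madd M N) (c + e).
Proof.
move=> [c0 hc] [e0 he]; split; first lra.
move=> v; rewrite mvmul_madd nsq_vadd.
have s0 := sqrt_pos (nsq v); have ss : sqrt (nsq v) ^ 2 = nsq v by rewrite pow2_sqrt //; apply: nsq_ge0.
have h : Rabs (Cre (vdot (mvmul M v) (mvmul N v))) <= (c * sqrt (nsq v)) * (e * sqrt (nsq v)).
  by apply: Cauchy_Schwarz_le; rewrite ?Rpow_mult_distr ?ss //; nra.
have := hc v; have := he v; have := Rle_abs (Cre (vdot (mvmul M v) (mvmul N v))); nra.
Qed.

(** From [|M^* v|^2 = <v, M M^* v> <= |v| c |M^* v|], one factor [|M^* v|] cancels unless it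
    vanishes. The proof works with the squares. *)
Lemma bounded_by_adj {n} (M : Mat n) c : bounded_by M c -> bounded_by (adj M) c.
Proof.
move=> [c0 hc]; split=> // v.
have h := Cauchy_Schwarz v (mvmul M (mvmul (adj M) v)).
have h' := hc (mvmul (adj M) v).
have e : Cre (vdot v (mvmul M (mvmul (adj M) v))) = nsq (mvmul (adj M) v) by rewrite vdot_adj.
move: h h'; rewrite e; set x := nsq (mvmul (adj M) v); set y := nsq (mvmul M _) => h h'.
have v0 := nsq_ge0 v; have x0 : 0 <= x := nsq_ge0 _.
case: (Rle_lt_dec x 0) => [?|xp]; first by nra.
apply: (Rmult_le_reg_r x) => //.
have : nsq v * y <= nsq v * (c ^ 2 * x) by apply: Rmult_le_compat_l.
nra.
Qed.

Lemma bounded_by_qform {n} (M : Mat n) c v : bounded_by M c -> Rabs (qform M v) <= c * nsq v.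
Proof.
move=> [c0 hc]; have s0 := sqrt_pos (nsq v).
have ss : sqrt (nsq v) ^ 2 = nsq v by rewrite pow2_sqrt //; apply: nsq_ge0.
have -> : c * nsq v = sqrt (nsq v) * (c * sqrt (nsq v)) by rewrite -{1}ss; ring.
by apply: Cauchy_Schwarz_le; rewrite ?Rpow_mult_distr ?ss //; [nra | lra].
Qed.

(** For a Hermitian matrix the numerical radius is the norm: testing on eigenvectors gives
    [|d i| <= c], and [M^* M] has the eigenvalues [(d i)^2]. *)
Lemma qform_bounded_by {n} (M : Mat n) c : hermitian M -> 0 <= c ->
  (forall v, Rabs (qform M v) <= c * nsq v) -> bounded_by M c.
Proof.
move=> hM c0 h; split=> // v.
have [U [d [hU e]]] := SpectralTransfer.spectral_theorem _ _ hM.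
rewrite -qform_gram hM e spec_mul //; apply: qform_spec_upper => // i.
have := h (eigvec U i); rewrite e qform_spec_eigvec // nsq_eigvec //.
move=> /Rabs_le_inv; nra.
Qed.

Lemma minv_smat {n} c : 0 < c -> minv (@smat n c) = smat (/ c).
Proof.
move=> c0; have h x y : x * y = 1 -> mmul (@smat n x) (smat y) = mI.
  by move=> e; rewrite /smat diag_mul e.
by apply: minv_unique; apply: h; field; lra.
Qed.

Lemma pd_smat {n} c : 0 < c -> pd (@smat n c).
Proof.
move=> c0; apply: (pd_lower c) => //; first exact: herm_diag.
move=> v; rewrite qform_smat; lra.
Qed.

Lemma pd_ge0 {n} (M : Mat n) v : pd M -> 0 <= qform M v.
Proof.
move=> hM; case: (classic (v = vzero)) => [->|ne].
  rewrite /qform mvmul_vzero -/(nsq vzero) nsq_vzero; lra.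
by apply/Rlt_le/(proj2 hM).
Qed.

Lemma bounded_by_minv {n} (M : Mat n) c : 0 < c -> hermitian M ->
  (forall v, c * nsq v <= qform M v) -> bounded_by (minv M) (/ c).
Proof.
move=> c0 hM h; have pM := pd_lower c M c0 hM h.
apply: qform_bounded_by; first exact: (proj1 (pd_minv _ pM)).
  by apply/Rlt_le/Rinv_0_lt_compat.
move=> v; rewrite Rabs_pos_eq; last exact/pd_ge0/pd_minv.
rewrite -qform_smat -minv_smat //; apply: minv_antitone => //; first exact: pd_smat.
by move=> w; rewrite qform_smat.
Qed.

Lemma mvmul_mpow {n} (X : Mat n) r r' v : pd X ->
  mvmul (mpow X r) (mvmul (mpow X r') v) = mvmul (mpow X (r + r')) v.
Proof. by move=> hX; rewrite -mvmul_mmul mpow_add. Qed.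

Lemma vdot_mpow {n} (X : Mat n) r r' u v : pd X ->
  vdot u (mvmul (mpow X (r + r')) v) = vdot (mvmul (mpow X r) u) (mvmul (mpow X r') v).
Proof.
by move=> hX; rewrite -mvmul_mpow // vdot_adj (proj1 (pd_mpow _ _ hX)).
Qed.

Lemma nsq_mpow {n} (X : Mat n) r v : pd X ->
  nsq (mvmul (mpow X (r / 2)) v) = qform (mpow X r) v.
Proof.
by move=> hX; rewrite /qform {2}(_ : r = r / 2 + r / 2) ?vdot_mpow //; field.
Qed.

(* If [X^r w = e Y^r w], pairing with [z = Y^((r1-r2)/2) w] and applying Cauchy-Schwarz to the
   factorisation [X^r = X^(r2/2) X^(r1/2)] gives [e <= 1]. *)
Lemma Loewner_Heinz_midpoint {n} (X Y : Mat n) r1 r2 : pd X -> pd Y ->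
  (forall v, qform (mpow X r1) v <= qform (mpow Y r1) v) ->
  (forall v, qform (mpow X r2) v <= qform (mpow Y r2) v) ->
  forall v, qform (mpow X ((r1 + r2) / 2)) v <= qform (mpow Y ((r1 + r2) / 2)) v.
Proof.
move=> hX hY h1 h2; set r := (r1 + r2) / 2.
(* [X^r <= Y^r] means that the eigenvalues [e i] of [S X^r S], with [S = Y^(-r/2)], are at most 1.
   An eigenvector [v] yields [w = S v] with [X^r w = e Y^r w]. *)
set S := mpow Y (- (r / 2)); have hS : adj S = S := proj1 (pd_mpow _ _ hY).
have hH : hermitian (mmul (adj S) (mmul (mpow X r) S)).
  by apply: herm_congr; apply: (proj1 (pd_mpow _ _ hX)).
have [V [e [hV eH]]] := SpectralTransfer.spectral_theorem _ _ hH.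
have SK v : mvmul S (mvmul (mpow Y (r / 2)) v) = v.
  by rewrite mvmul_mpow // (_ : _ + _ = 0) ?mpow_0 ?mvmul_1 //; ring.
have KS v : mvmul (mpow Y (r / 2)) (mvmul S v) = v.
  by rewrite mvmul_mpow // (_ : _ + _ = 0) ?mpow_0 ?mvmul_1 //; ring.
have e1 i : e i <= 1.
  set v := eigvec V i; set w := mvmul S v; set z := mvmul (mpow Y ((r1 - r2) / 2)) w.
  have v0 : v <> vzero by apply: eigvec_neq0.
  have w0 : w <> vzero by move=> w0; apply: v0; rewrite -(KS v) -/w w0 mvmul_vzero.
  have eX : mvmul (mpow X r) w = vscale (RtoC (e i)) (mvmul (mpow Y r) w).
    have := f_equal (mvmul (mpow Y (r / 2))) (mvmul_spec_eigvec V e i hV).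
    rewrite -eH hS !mvmul_mmul KS mvmul_vscale -/v -/w => ->.
    by rewrite -{1}(KS v) -/w mvmul_mpow //; congr (vscale _ (mvmul (mpow _ _) _)); field.
  have ez : mvmul (mpow Y (r2 / 2)) z = mvmul (mpow Y (r1 / 2)) w.
    by rewrite mvmul_mpow //; congr (mvmul (mpow _ _) _); field.
  set N := qform (mpow Y r1) w.
  have N0 : 0 < N by apply: (proj2 (pd_mpow _ _ hY)).
  have hr : r = r2 / 2 + r1 / 2 by rewrite /r; field.
  (* The left side becomes [(e N)^2]. Both factors on the right are at most [N], since [z] is chosen
     so that [Y^(r2/2) z = Y^(r1/2) w]. *)
  have := Cauchy_Schwarz (mvmul (mpow X (r2 / 2)) z) (mvmul (mpow X (r1 / 2)) w).
  rewrite -vdot_mpow // -hr eX vdot_vscale_r hr vdot_mpow // ez !nsq_mpow //.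
  have -> : Cre (Cmul (RtoC (e i)) (vdot (mvmul (mpow Y (r1 / 2)) w) (mvmul (mpow Y (r1 / 2)) w))) = e i * N.
    by rewrite /N -nsq_mpow // /nsq /=; ring.
  have := h2 z; rewrite -(nsq_mpow Y) // ez nsq_mpow // -/N.
  have := h1 w; rewrite -/N.
  have := pd_ge0 _ w (pd_mpow _ r1 hX); have := pd_ge0 _ z (pd_mpow _ r2 hX).
  move: (qform _ z) (qform _ w) => x y x0 y0 hy hx h.
  have hxy : x * y <= N * N by apply: Rmult_le_compat.
  case: (Rle_lt_dec (e i) 1) => // e1; have : N < e i * N by nra.
  nra.
move=> u; have := qform_congr S (mpow X r) (mvmul (mpow Y (r / 2)) u).
rewrite SK => <-; rewrite eH -nsq_mpow //.
by have := qform_spec_upper V e 1 (mvmul (mpow Y (r / 2)) u) hV e1; rewrite Rmult_1_l.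
Qed.

(** Bisection: [r] is bracketed between two points of [P] at distance at most [2^-k], and closedness
    is applied to the left ends. *)
Lemma midpoint_closed_unit_interval (P : R -> Prop) : P 0 -> P 1 ->
  (forall x y, P x -> P y -> P ((x + y) / 2)) ->
  (forall u l, (forall k : nat, P (u k)) -> Un_cv u l -> P l) ->
  forall r, 0 <= r <= 1 -> P r.
Proof.
move=> P0 P1 Pm Pc r hr.
have H k : exists x, P x /\ exists y, P y /\ x <= r <= y /\ y - x <= (/ 2) ^ k.
  elim: k => [|k [x [Px [y [Py [h1 h2]]]]]].
    by exists 0; split=> //; exists 1; split=> //; split=> //=; lra.
  have Pxy := Pm _ _ Px Py; case: (Rle_lt_dec r ((x + y) / 2)) => h.
    by exists x; split=> //; exists ((x + y) / 2); split=> //=; split; lra.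
  by exists ((x + y) / 2); split=> //; exists y; split=> //=; split; lra.
have [u hu] : exists u : nat -> R, forall k,
    P (u k) /\ exists y, P y /\ u k <= r <= y /\ y - u k <= (/ 2) ^ k.
  (* The brackets are chosen separately for each [k] and need not be nested; their length alone
     forces [u k] to tend to [r]. *)
  exists (fun k => proj1_sig (constructive_indefinite_description _ (H k))) => k.
  exact: (proj2_sig (constructive_indefinite_description _ (H k))).
apply: (Pc u) => [k|eps eps0]; first by case: (hu k).
have [N hN] := pow_lt_1_zero (/ 2) ltac:(rewrite Rabs_pos_eq; lra) eps eps0.
exists N => k kN; have [_ [y [_ [h1 h2]]]] := hu k.
have := hN k kN; rewrite /Rdist Rabs_pos_eq; last by apply: pow_le; lra.
rewrite Rabs_left1; lra.
Qed.

Lemma Un_cv_fsum n (f : nat -> Fin.t n -> C) g :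
  (forall i, Un_cv (fun k => Cre (f k i)) (Cre (g i))) ->
  Un_cv (fun k => Cre (fsum n (f k))) (Cre (fsum n g)).
Proof.
elim: n f g => [|n IH] f g h /=.
  by move=> eps e0; exists 0%nat => k _; rewrite /Rdist Rminus_0_r Rabs_R0.
apply: CV_plus; first exact: h.
by apply: (IH (fun k i => f k (Fin.FS i)) (fun i => g (Fin.FS i))).
Qed.

Lemma Un_cv_const c : Un_cv (fun _ => c) c.
Proof. by move=> eps e0; exists 0%nat => k _; rewrite /Rdist Rminus_diag Rabs_R0. Qed.

(** In the eigenframe of [X] the form is a finite sum of terms [(d i)^(u k) |w i|^2], each
    continuous in the exponent. This is the closedness of the set of admissible exponents. *)
Lemma Un_cv_qform_mpow {n} (X : Mat n) u l v : pd X -> Un_cv u l ->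
  Un_cv (fun k => qform (mpow X (u k)) v) (qform (mpow X l) v).
Proof.
move=> /pd_spectral [U [d [hU [d0 ->]]]] hu.
rewrite mpow_spec // qform_spec; set w := mvmul _ _.
have -> : (fun k => qform (mpow (spec U d) (u k)) v) = fun k => qform (diag (fun i => Rpower (d i) (u k))) w.
  by apply: functional_extensionality => k; rewrite mpow_spec // qform_spec.
apply: Un_cv_fsum => i.
have E x : Cre (Cmul (Cconj (w i)) (mvmul (diag (fun i => Rpower (d i) x)) w i))
   = Rpower (d i) x * (Cre (w i) ^ 2 + Cim (w i) ^ 2) by rewrite mvmul_diag /=; ring.
rewrite E; have -> : (fun k => Cre (Cmul (Cconj (w i)) (mvmul (diag (fun i => Rpower (d i) (u k))) w i)))
  = fun k => Rpower (d i) (u k) * (Cre (w i) ^ 2 + Cim (w i) ^ 2).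
  by apply: functional_extensionality => k; rewrite E.
apply: CV_mult; last exact: Un_cv_const.
apply: (continuity_seq exp (fun k => u k * ln (d i))).
  exact/derivable_continuous_pt/derivable_pt_exp.
by apply: CV_mult => //; apply: Un_cv_const.
Qed.

Lemma Loewner_Heinz {n} (X Y : Mat n) : pd X -> pd Y ->
  (forall v, qform X v <= qform Y v) -> forall r, 0 <= r <= 1 ->
  forall v, qform (mpow X r) v <= qform (mpow Y r) v.
Proof.
move=> hX hY h.
apply: (midpoint_closed_unit_interval
  (fun r => forall v, qform (mpow X r) v <= qform (mpow Y r) v)).
- by move=> v; rewrite !mpow_0 //; lra.
- by move=> v; rewrite !mpow_1.
- by move=> x y; apply: Loewner_Heinz_midpoint.
move=> u l hu cu v; apply: (@Rle_cv_lim (fun k => qform (mpow X (u k)) v)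
  (fun k => qform (mpow Y (u k)) v)) => [k||]; [exact: hu | | ]; exact: Un_cv_qform_mpow.
Qed.

(** Mean value theorem: since [r <= 1], the size [|r| x^(r-1)] of the derivative is largest at the
    left end [a]. Negative [r] is included, which serves the power [-p/t]. *)
Lemma Rpower_lip a d e r : 0 < a -> a <= d -> 0 <= e -> r <= 1 ->
  Rabs (Rpower (d + e) r - Rpower d r) <= Rabs r * Rpower a (r - 1) * e.
Proof.
(* The mean value theorem needs a nondegenerate interval, hence the separate case [e = 0]. *)
move=> a0 ad e0 r1; case: (Req_dec e 0) => [->|ne].
  by rewrite Rplus_0_r Rminus_diag Rabs_R0; lra.
have [|c hc|c [-> hc]] := MVT_cor2 (fun x => Rpower x r) (fun x => r * Rpower x (r - 1)) d (d + e).
- lra.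
- apply: derivable_pt_lim_power; lra.
have -> : d + e - d = e by ring.
rewrite !Rabs_mult (Rabs_pos_eq e) // (Rabs_pos_eq (Rpower _ _)); last exact/Rlt_le/Rpower_pos.
apply: Rmult_le_compat_r => //; apply: Rmult_le_compat_l; first exact: Rabs_pos.
apply: Rpower_le_neg; lra.
Qed.

(** [W = Y + e I] has the eigenvectors of [Y], so passing from [W] to [Y] is a scalar estimate. The
    second bound comes from inverting [X^r <= W^r] and applying the scalar estimate at [-r]. *)
Lemma mpow_lip_half {n} (X Y : Mat n) a e r : 0 < a -> 0 <= e -> 0 <= r <= 1 ->
  pd X -> hermitian Y -> (forall v, a * nsq v <= qform Y v) ->
  (forall v, qform X v <= qform Y v + e * nsq v) -> forall v,
  qform (mpow X r) v <= qform (mpow Y r) v + r * Rpower a (r - 1) * e * nsq v /\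
  qform (mpow Y (- r)) v - r * Rpower a (- r - 1) * e * nsq v <= qform (mpow X (- r)) v.
Proof.
move=> a0 e0 hr hX hY hYa hXY v.
have [U [d [hU [hd eY]]]] := lower_spectral Y a hY hYa.
set W := spec U (fun i => d i + e).
have d0 i : 0 < d i by have := hd i; lra.
have de0 i : 0 < d i + e by have := d0 i; lra.
have hW : pd W by apply: pd_spec.
have XW w : qform X w <= qform W w.
  by rewrite /W -spec_madd qform_madd -eY spec_smat // qform_smat.
have h1 := Loewner_Heinz X W hX hW XW r hr.
have h2 := minv_antitone _ _ (pd_mpow X r hX) (pd_mpow W r hW) h1.
have hinv Z : pd Z -> minv (mpow Z r) = mpow Z (- r).
  by move=> hZ; rewrite minv_mpow ?mpow_mpow //; [congr mpow; ring | apply: pd_mpow].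
rewrite !hinv // in h2.
split.
  apply: Rle_trans (h1 v) _; rewrite eY /W !mpow_spec //.
  rewrite -qform_smat -(spec_smat U) // -qform_madd spec_madd.
  apply: qform_spec_le => i; have := Rpower_lip a (d i) e r a0 (hd i) e0 ltac:(lra).
  by rewrite (Rabs_pos_eq r); [move=> /Rabs_le_inv; lra | lra].
suff : qform (mpow Y (- r)) v <= qform (mpow W (- r)) v + r * Rpower a (- r - 1) * e * nsq v.
  by have := h2 v; lra.
rewrite eY /W !mpow_spec //.
rewrite -qform_smat -(spec_smat U) // -qform_madd spec_madd.
apply: qform_spec_le => i; have := Rpower_lip a (d i) e (- r) a0 (hd i) e0 ltac:(lra).
by rewrite Rabs_Ropp (Rabs_pos_eq r); [move=> /Rabs_le_inv; lra | lra].
Qed.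

(** Exchanging [X] and [Y] makes the one-sided estimates two-sided; for the Hermitian differences
    such a bound on the quadratic form is a norm bound. *)
Lemma mpow_lip {n} (X Y : Mat n) a e r : 0 < a -> 0 <= e -> 0 <= r <= 1 ->
  hermitian X -> (forall v, a * nsq v <= qform X v) ->
  hermitian Y -> (forall v, a * nsq v <= qform Y v) ->
  bounded_by (msub X Y) e ->
  bounded_by (msub (mpow X r) (mpow Y r)) (r * Rpower a (r - 1) * e) /\
  bounded_by (msub (mpow X (- r)) (mpow Y (- r))) (r * Rpower a (- r - 1) * e).
Proof.
move=> a0 e0 hr hX hXa hY hYa hXY.
have pX := pd_lower a X a0 hX hXa; have pY := pd_lower a Y a0 hY hYa.
have hq v : - (e * nsq v) <= qform X v - qform Y v <= e * nsq v.
  by apply: Rabs_le_inv; rewrite -qform_msub; apply: bounded_by_qform.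
have H1 := mpow_lip_half X Y a e r a0 e0 hr pX hY hYa (fun v => ltac:(have := hq v; lra)).
have H2 := mpow_lip_half Y X a e r a0 e0 hr pY hX hXa (fun v => ltac:(have := hq v; lra)).
have nn x : 0 <= r * Rpower a x * e.
  by apply: Rmult_le_pos => //; apply: Rmult_le_pos; [lra | apply/Rlt_le/Rpower_pos].
have hh Z x : pd Z -> hermitian (mpow Z x) by move=> hZ; apply: (proj1 (pd_mpow _ _ hZ)).
by split; apply: qform_bounded_by => //; try (by apply: herm_msub; apply: hh);
  move=> v; rewrite qform_msub; apply: Rabs_le; have := H1 v; have := H2 v; lra.
Qed.

(** * Completeness and fixed points *)

Lemma madd_msub {n} (M N P : Mat n) : madd (msub M N) (msub N P) = msub M P.
Proof. by apply: mat_ext => i j; rewrite /madd /msub; ring. Qed.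

Lemma mnorm_triangle {n} (M N P : Mat n) : (1 <= n)%nat ->
  mnorm (msub M P) <= mnorm (msub M N) + mnorm (msub N P).
Proof.
move=> n1; apply: mnorm_le => //; rewrite -(madd_msub M N P).
by apply: bounded_by_madd; apply: mnorm_bound.
Qed.

Lemma mnorm_entry {n} (M : Mat n) i j : (1 <= n)%nat ->
  Rabs (Cre (M i j)) <= mnorm M /\ Rabs (Cim (M i j)) <= mnorm M.
Proof.
move=> n1; have [c0 hc] := mnorm_bound M n1.
have := hc (basis_vec j); have := nsq_ge (mvmul M (basis_vec j)) i.
rewrite nsq_basis mvmul_basis => h1 h2.
by split; (apply: Rsqr_incr_0_var => //); rewrite -Rsqr_abs /Rsqr; nra.
Qed.

Lemma mnorm_msub_eq0 {n} (M N : Mat n) : (1 <= n)%nat -> mnorm (msub M N) <= 0 -> M = N.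
Proof.
move=> n1 h; apply: mat_ext => i j; have [] := mnorm_entry (msub M N) i j n1.
move: (mnorm _) h => c c0 /Rabs_le_inv h1 /Rabs_le_inv h2.
by apply: C_ext; move: h1 h2; rewrite /msub /=; lra.
Qed.

Lemma mnorm_msubC {n} (M N : Mat n) : (1 <= n)%nat -> mnorm (msub M N) = mnorm (msub N M).
Proof.
move=> n1; suff h (P S : Mat n) : mnorm (msub P S) <= mnorm (msub S P) by apply: Rle_antisym.
apply: mnorm_le => //; have [c0 hc] := mnorm_bound (msub S P) n1; split=> // v.
have -> : msub P S = mmul (smat (-1)) (msub S P).
  by apply: mat_ext => i j; rewrite mmul_diag_l; apply: C_ext => /=; ring.
rewrite mvmul_mmul mvmul_smat nsq_vscale; have := hc v; lra.
Qed.

(** Convergence is entrywise so that completeness reduces to that of the reals; order and norm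
    estimates pass to the limit through quadratic forms. *)
Definition mcv {n} (u : nat -> Mat n) (L : Mat n) : Prop :=
  forall i j, Un_cv (fun k => Cre (u k i j)) (Cre (L i j)) /\
              Un_cv (fun k => Cim (u k i j)) (Cim (L i j)).

Lemma mcv_complete {n} (u : nat -> Mat n) (e : nat -> R) : (1 <= n)%nat -> Un_cv e 0 ->
  (forall k m, (k <= m)%nat -> mnorm (msub (u m) (u k)) <= e k) -> exists L, mcv u L.
Proof.
move=> n1 he hu.
have cauchy f : (forall k m, (k <= m)%nat -> Rabs (f m - f k) <= e k) -> { l | Un_cv f l }.
  move=> hf; apply: R_complete => eps e0; have [N hN] := he eps e0; exists N => k m kN mN.
  have ek k' : (k' >= N)%nat -> e k' < eps.
    by move=> /hN; rewrite /Rdist Rminus_0_r; have := Rle_abs (e k'); lra.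
  rewrite /Rdist; case: (PeanoNat.Nat.le_ge_cases k m) => h.
    by rewrite Rabs_minus_sym; apply: Rle_lt_trans (hf _ _ h) _; apply: ek.
  by apply: Rle_lt_trans (hf _ _ h) _; apply: ek.
have hre i j k m (h : (k <= m)%nat) : Rabs (Cre (u m i j) - Cre (u k i j)) <= e k.
  by apply: Rle_trans (hu k m h); apply: (proj1 (mnorm_entry (msub (u m) (u k)) i j n1)).
have him i j k m (h : (k <= m)%nat) : Rabs (Cim (u m i j) - Cim (u k i j)) <= e k.
  by apply: Rle_trans (hu k m h); apply: (proj2 (mnorm_entry (msub (u m) (u k)) i j n1)).
exists (fun i j => mkC (proj1_sig (cauchy _ (hre i j))) (proj1_sig (cauchy _ (him i j)))).
by move=> i j /=; split; [case: (cauchy _ (hre i j)) | case: (cauchy _ (him i j))].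
Qed.

Lemma mcv_qform {n} (u : nat -> Mat n) L v : mcv u L ->
  Un_cv (fun k => qform (u k) v) (qform L v).
Proof.
move=> h.
have E M : qform M v = Cre (fsum n (fun i => fsum n (fun j => Cmul (Cmul (Cconj (v i)) (v j)) (M i j)))).
  rewrite /qform /vdot /mvmul; congr Cre; apply: fsum_ext => i; rewrite -fsum_mull.
  by apply: fsum_ext => j; ring.
rewrite E (functional_extensionality _ _ (fun k => E (u k))).
apply: (Un_cv_fsum n (fun k i => fsum n (fun j => Cmul (Cmul (Cconj (v i)) (v j)) (u k i j)))) => i.
apply: (Un_cv_fsum n (fun k j => Cmul (Cmul (Cconj (v i)) (v j)) (u k i j))) => j.
have [h1 h2] := h i j.
apply: CV_minus; by apply: CV_mult => //; apply: Un_cv_const.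
Qed.

Lemma mcv_herm {n} (u : nat -> Mat n) L : mcv u L -> (forall k, hermitian (u k)) -> hermitian L.
Proof.
move=> h hu; apply: mat_ext => i j; have [h1 h2] := h i j; have [h3 h4] := h j i.
have e k : u k i j = Cconj (u k j i) by rewrite -{1}(hu k).
apply: C_ext => /=.
  apply: UL_sequence h3 _; move: h1; rewrite (_ : (fun k => _) = fun k => Cre (u k j i)) //.
  by apply: functional_extensionality => k; rewrite e.
apply: (UL_sequence (fun k => Cim (u k i j))) => //.
rewrite (_ : (fun k => _) = opp_seq (fun k => Cim (u k j i))); first exact: CV_opp.
by apply: functional_extensionality => k; rewrite e.
Qed.

Lemma mcv_interval {n} (u : nat -> Mat n) L P R0 : mcv u L -> hermitian P -> hermitian R0 ->
  (forall k, in_interval P R0 (u k)) -> in_interval P R0 L.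
Proof.
move=> h hP hR hu; have hL : hermitian L by apply: (mcv_herm u) => // k; apply: herm_interval (hu k).
split=> //; split; apply: qform_mle => // v.
  apply: (@Rle_cv_lim (fun _ => qform P v) (fun k => qform (u k) v)).
  - by move=> k; apply: mle_qform; case: (hu k) => [_ []].
  - exact: Un_cv_const.
  - exact: mcv_qform.
apply: (@Rle_cv_lim (fun k => qform (u k) v) (fun _ => qform R0 v)).
- by move=> k; apply: mle_qform; case: (hu k) => [_ []].
- exact: mcv_qform.
- exact: Un_cv_const.
Qed.

(** For Hermitian matrices a norm bound is a family of non-strict scalar inequalities, one for each
    vector, and these survive limits. *)
Lemma mcv_mnorm {n} (u : nat -> Mat n) L k e : (1 <= n)%nat -> mcv u L ->
  (forall k, hermitian (u k)) ->
  (forall m, (k <= m)%nat -> mnorm (msub (u m) (u k)) <= e) -> mnorm (msub L (u k)) <= e.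
Proof.
move=> n1 h hu he; have hL := mcv_herm u L h hu.
have e0 : 0 <= e by apply: Rle_trans (he k _); [apply: mnorm_ge0 | lia].
apply: mnorm_le => //; apply: qform_bounded_by => //; first exact: herm_msub.
(* Shifting by [k] makes every index at least [k], where the bound [he] holds. *)
move=> v; have cv := CV_shift' _ k _ (mcv_qform u L v h).
have hq m : - (e * nsq v) <= qform (u (m + k)%nat) v - qform (u k) v <= e * nsq v.
  apply: Rabs_le_inv; rewrite -qform_msub.
  apply: Rle_trans (bounded_by_qform _ _ v (mnorm_bound _ n1)) _.
  by apply: Rmult_le_compat_r; [apply: nsq_ge0 | apply: he; lia].
rewrite qform_msub; apply: Rabs_le; split.
  suff : qform (u k) v - e * nsq v <= qform L v by lra.
  apply: (@Rle_cv_lim (fun _ => _) _ _ _ _ (Un_cv_const _) cv) => m; have := hq m; lra.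
suff : qform L v <= qform (u k) v + e * nsq v by lra.
apply: (@Rle_cv_lim _ (fun _ => _) _ _ _ cv (Un_cv_const _)) => m; have := hq m; lra.
Qed.

(** Banach iteration from [X0]: the Loewner interval is closed under [mcv], so the limit stays where
    the contraction estimate holds. *)
Lemma interval_contraction_fixpoint {n} (P R0 X0 : Mat n) (G : Mat n -> Mat n) delta :
  (1 <= n)%nat -> 0 <= delta < 1 -> hermitian P -> hermitian R0 -> in_interval P R0 X0 ->
  (forall X, in_interval P R0 X -> in_interval P R0 (G X)) ->
  (forall X Y, in_interval P R0 X -> in_interval P R0 Y ->
     mnorm (msub (G X) (G Y)) <= delta * mnorm (msub X Y)) ->
  exists L, in_interval P R0 L /\ G L = L.
Proof.
move=> n1 hd hP hR hX0 hG hc.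
pose u := fix u k := match k with O => X0 | S k => G (u k) end.
have hu k : in_interval P R0 (u k) by elim: k => //= k IH; apply: hG.
set D := mnorm (msub (u 1%nat) (u 0%nat)).
have D0 : 0 <= D by apply: mnorm_ge0.
have step k : mnorm (msub (u (S k)) (u k)) <= delta ^ k * D.
  elim: k => [|k IH]; first by rewrite pow_O Rmult_1_l; apply: Rle_refl.
  apply: Rle_trans (hc _ _ (hu (S k)) (hu k)) _.
  rewrite -tech_pow_Rmult Rmult_assoc; apply: Rmult_le_compat_l => //; lra.
(* The last factor is the partial geometric sum [1 + delta + ... + delta^(m-1)]. *)
have far k m : mnorm (msub (u (m + k)%nat) (u k)) <= delta ^ k * D * ((1 - delta ^ m) / (1 - delta)).
  elim: m => [|m IH].
    rewrite /= (_ : _ * _ = 0); last by field; lra.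
    apply: mnorm_le => //; split; first lra.
    move=> v; rewrite (_ : mvmul _ v = vzero) ?nsq_vzero; first nra.
    apply: vec_ext => i; rewrite /mvmul /vzero -[RHS](fsum_0 n).
    by apply: fsum_ext => j; rewrite /msub; ring.
  apply: Rle_trans (mnorm_triangle _ (u (m + k)%nat) _ n1) _.
  apply: Rle_trans (Rplus_le_compat _ _ _ _ (step (m + k)%nat) IH) _.
  by right; rewrite pow_add /=; field; lra.
pose e k := delta ^ k * (D / (1 - delta)).
have dk k : 0 <= delta ^ k by apply: pow_le; lra.
have Dd : 0 <= D / (1 - delta) by apply: Rmult_le_pos => //; apply/Rlt_le/Rinv_0_lt_compat; lra.
have he k m : (k <= m)%nat -> mnorm (msub (u m) (u k)) <= e k.
  move=> km; have := far k (m - k)%nat; rewrite (_ : m - k + k = m)%nat; last lia.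
  move=> /Rle_trans; apply.
  rewrite /e (_ : delta ^ k * D * _ = delta ^ k * (D / (1 - delta)) * (1 - delta ^ (m - k))); last by field; lra.
  have := Rmult_le_pos _ _ (dk k) Dd; have := dk (m - k)%nat; nra.
have e_cv : Un_cv e 0.
  rewrite -(Rmult_0_l (D / (1 - delta))); apply: CV_mult; last exact: Un_cv_const.
  move=> eps eps0; have [N hN] := pow_lt_1_zero delta ltac:(rewrite Rabs_pos_eq; lra) eps eps0.
  by exists N => k kN; rewrite /Rdist Rminus_0_r; apply: hN.
have [L hL] := mcv_complete u e n1 e_cv he.
have uh k : hermitian (u k) by apply: herm_interval (hu k).
have LI : in_interval P R0 L by apply: (mcv_interval u).
exists L; split; [exact: LI|].
apply: (mnorm_msub_eq0 _ _ n1).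
have Le k : mnorm (msub L (u k)) <= e k by apply: (mcv_mnorm u L k (e k) n1 hL uh) => m; apply: he.
(* The distance from [G L] to [L], measured through [u (S k)], is at most [delta e_k + e_(k+1)] for
   every [k], and this tends to 0. *)
apply: (@Rle_cv_lim (fun _ => mnorm (msub (G L) L)) (fun k => delta * e k + e (S k))).
- move=> k; apply: Rle_trans (mnorm_triangle _ (u (S k)) _ n1) _; apply: Rplus_le_compat.
    apply: Rle_trans (hc _ _ LI (hu k)) _; apply: Rmult_le_compat_l; [lra | exact: Le].
  by rewrite mnorm_msubC.
- exact: Un_cv_const.
rewrite -(Rplus_0_r 0) -{1}(Rmult_0_r delta); apply: CV_plus.
  by apply: CV_mult => //; apply: Un_cv_const.
move=> eps eps0; have [N hN] := e_cv eps eps0; exists N => k kN; apply: hN; lia.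
Qed.

(** * Congruence by invertible matrices *)

Lemma invertible_adj {n} (S : Mat n) : invertible S -> invertible (adj S).
Proof.
move=> [T [h1 h2]]; exists (adj T); rewrite -!adj_mmul h1 h2.
by split; apply: adj_diag.
Qed.

Lemma invertible_inj {n} (S : Mat n) v : invertible S -> mvmul S v = vzero -> v = vzero.
Proof.
by move=> [T [_ h]] e; rewrite -(mvmul_1 v) -h mvmul_mmul e mvmul_vzero.
Qed.

Lemma pd_congr {n} (S M : Mat n) : pd M -> invertible S -> pd (mmul (adj S) (mmul M S)).
Proof.
move=> [hM h] hS; split; first exact: herm_congr.
move=> v v0; rewrite -/(qform _ v) qform_congr; apply: h => e; apply: v0.
exact: invertible_inj hS e.
Qed.

Lemma pd_mI {n} : pd (@mI n).
Proof. by apply: pd_smat; lra. Qed.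

Lemma pd_gram {n} (S : Mat n) : invertible S -> pd (mmul (adj S) S).
Proof. by move=> hS; rewrite -{2}(mmul_1_l S); apply: pd_congr => //; apply: pd_mI. Qed.

(* [(S^* M S)^-1 = S^-1 M^-1 (S^-1)^*], in the form that avoids naming [S^-1]. *)
Lemma congr_minv {n} (S M : Mat n) : invertible S -> invertible M ->
  mmul S (mmul (minv (mmul (adj S) (mmul M S))) (adj S)) = minv M.
Proof.
move=> [T [h1 h2]] /minv_invertible [m1 m2].
have h1' : mmul (adj T) (adj S) = mI by rewrite -adj_mmul h1; apply: adj_diag.
have h2' : mmul (adj S) (adj T) = mI by rewrite -adj_mmul h2; apply: adj_diag.
rewrite (minv_unique _ (mmul T (mmul (minv M) (adj T)))).
- by rewrite -!mmul_assoc h1' mmul_1_r mmul_assoc h1 mmul_1_l.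
- by rewrite -!mmul_assoc (mmul_assoc S T) h1 mmul_1_l (mmul_assoc M) m1 mmul_1_l.
- by rewrite -!mmul_assoc (mmul_assoc (adj T)) h1' mmul_1_l (mmul_assoc (minv M)) m2 mmul_1_l.
Qed.

(** * The contraction *)

(** Hypothesis (ii) and the eigenvalue definitions of [a] and [theta] recast as quadratic form
    inequalities: [set_lower] is [a I <= A Q^-1 A^*] and [set_gram] is [theta I <= b^-1 A^* A]. *)
Record setting {n} (s t p : R) (A B Q : Mat n) (a b theta : R) : Prop := {
  set_n : (1 <= n)%nat;
  set_s : 0 < s / t <= 1;
  set_p : 0 < p / t <= 1;
  set_A : invertible A;
  set_Q : pd Q;
  set_a : 0 < a;
  set_ab : a < b;
  set_theta : 0 < theta;
  set_lower : forall v, a * nsq v <= qform (mmul A (mmul (minv Q) (adj A))) v;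
  set_gram : forall v, theta * nsq v <= / b * nsq (mvmul A v);
  set_upper : forall v,
    / b * nsq (mvmul A v) + Rpower b (s / t) * nsq v + Rpower a (- p / t) * nsq (mvmul B v)
    <= qform Q v }.

(** The matrix inverted inside [Fmap], called [M] in the overview. *)
Definition core {n} (s t p : R) (B Q X Y : Mat n) : Mat n :=
  msub (msub Q (mpow X (s / t))) (mmul (adj B) (mmul (mpow Y (- p / t)) B)).

Lemma qform_core {n} s t p (B Q X Y : Mat n) v :
  qform (core s t p B Q X Y) v =
  qform Q v - qform (mpow X (s / t)) v - qform (mpow Y (- p / t)) (mvmul B v).
Proof. by rewrite /core !qform_msub qform_congr. Qed.

Lemma qform_outer {n} (S M : Mat n) v :
  qform (mmul S (mmul M (adj S))) v = qform M (mvmul (adj S) v).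
Proof. by rewrite -{1}(adj_adj S) qform_congr. Qed.

Lemma qform_interval {n} (P R0 X : Mat n) v : in_interval P R0 X ->
  qform P v <= qform X v <= qform R0 v.
Proof. by move=> [_ [h1 h2]]; split; apply: mle_qform. Qed.

Lemma qform_in_interval {n} (P R0 X : Mat n) : hermitian P -> hermitian X -> hermitian R0 ->
  (forall v, qform P v <= qform X v <= qform R0 v) -> in_interval P R0 X.
Proof.
by move=> hP hX hR h; split=> //; split; apply: qform_mle => // v; case: (h v).
Qed.

Lemma smat_in_interval {n} a b c : a <= c <= b -> in_interval (@smat n a) (smat b) (smat c).
Proof.
move=> h; apply: qform_in_interval; try exact: herm_diag.
by move=> v; rewrite !qform_smat; have := nsq_ge0 v; nra.
Qed.

Lemma neg_div p t : - p / t = - (p / t).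
Proof. by rewrite /Rdiv Ropp_mult_distr_l. Qed.

Section Setting.
Context {n : nat} {s t p : R} {A B Q : Mat n} {a b theta : R}.
Context (H : setting s t p A B Q a b theta).

Let n1 := set_n _ _ _ _ _ _ _ _ _ H.
Let hs := set_s _ _ _ _ _ _ _ _ _ H.
Let hp := set_p _ _ _ _ _ _ _ _ _ H.
Let hA := set_A _ _ _ _ _ _ _ _ _ H.
Let hQ := set_Q _ _ _ _ _ _ _ _ _ H.
Let a0 := set_a _ _ _ _ _ _ _ _ _ H.
Let ab := set_ab _ _ _ _ _ _ _ _ _ H.
Let th0 := set_theta _ _ _ _ _ _ _ _ _ H.

Let I (X : Mat n) := in_interval (smat a) (smat b) X.
Let M := core s t p B Q.
Let F := Fmap s t p A B Q.

Lemma I_lower X v : I X -> a * nsq v <= qform X v.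
Proof. by move=> hX; rewrite -qform_smat; case: (qform_interval _ _ _ v hX). Qed.

Lemma qform_pow_s X v : I X ->
  Rpower a (s / t) * nsq v <= qform (mpow X (s / t)) v <= Rpower b (s / t) * nsq v.
Proof.
move=> hX; rewrite -!qform_smat; apply: qform_interval; apply: mpow_interval => //; lra.
Qed.

Lemma qform_pow_p X v : I X ->
  Rpower b (- p / t) * nsq v <= qform (mpow X (- p / t)) v <= Rpower a (- p / t) * nsq v.
Proof.
move=> hX; rewrite -!qform_smat; apply: qform_interval; apply: mpow_interval_neg => //.
by rewrite neg_div; lra.
Qed.

Lemma herm_core X Y : I X -> I Y -> hermitian (M X Y).
Proof.
move=> hX hY; apply: herm_msub.
  by apply: herm_msub; [case: hQ | apply: (proj1 (pd_mpow _ _ (pd_interval _ _ _ a0 hX)))].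
by apply: herm_congr; apply: (proj1 (pd_mpow _ _ (pd_interval _ _ _ a0 hY))).
Qed.

(** Hypothesis (ii) is the worst case over the interval: [X^(s/t)] is at most [b^(s/t) I] and
    [Y^(-p/t)] is at most [a^(-p/t) I]. *)
Lemma core_gram X Y v : I X -> I Y -> / b * nsq (mvmul A v) <= qform (M X Y) v.
Proof.
move=> hX hY; rewrite qform_core; have := set_upper _ _ _ _ _ _ _ _ _ H v.
have := qform_pow_s X v hX; have := qform_pow_p Y (mvmul B v) hY; lra.
Qed.

Lemma core_lower X Y v : I X -> I Y -> theta * nsq v <= qform (M X Y) v.
Proof.
move=> hX hY; apply: Rle_trans (core_gram X Y v hX hY); exact: set_gram H v.
Qed.

Lemma core_pd X Y : I X -> I Y -> pd (M X Y).
Proof.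
by move=> hX hY; apply: (pd_lower theta) => //; [exact: herm_core | move=> v; apply: core_lower].
Qed.

Lemma core_le_Q X Y v : I X -> I Y -> qform (M X Y) v <= qform Q v.
Proof.
move=> hX hY; rewrite qform_core.
have := pd_ge0 _ v (pd_mpow _ (s / t) (pd_interval _ _ _ a0 hX)).
have := pd_ge0 _ (mvmul B v) (pd_mpow _ (- p / t) (pd_interval _ _ _ a0 hY)); lra.
Qed.

Lemma herm_F X Y : I X -> I Y -> hermitian (F X Y).
Proof.
by move=> hX hY; apply: herm_congr'; apply: (proj1 (pd_minv _ (core_pd _ _ hX hY))).
Qed.

Lemma F_antitone X Y X' Y' : I X -> I Y -> I X' -> I Y' ->
  (forall v, qform (M X Y) v <= qform (M X' Y') v) ->
  forall v, qform (F X' Y') v <= qform (F X Y) v.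
Proof.
move=> hX hY hX' hY' h v; rewrite !qform_outer.
by apply: minv_antitone => //; apply: core_pd.
Qed.

Lemma F_interval X Y : I X -> I Y -> I (F X Y).
Proof.
move=> hX hY; have b0 : 0 < b by move: a0 ab; lra.
apply: qform_in_interval; try exact: herm_diag; first exact: herm_F.
move=> v; rewrite !qform_smat; split.
  apply: Rle_trans (set_lower _ _ _ _ _ _ _ _ _ H v) _; rewrite !qform_outer.
  by apply: minv_antitone => //; [exact: core_pd | move=> w; apply: core_le_Q].
have pb : pd (@smat n (/ b)) by apply: pd_smat; apply: Rinv_0_lt_compat.
(* Replacing [M] by its lower bound [A^* (b^-1 I) A] turns [A M^-1 A^*] into exactly [b I]. *)
have e := congr_minv A (smat (/ b)) hA (pd_invertible _ pb).
rewrite -(Rinv_inv b) -qform_smat -minv_smat; last exact: Rinv_0_lt_compat.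
rewrite -e !qform_outer; apply: minv_antitone.
- exact: pd_congr.
- exact: core_pd.
by move=> w; rewrite qform_congr qform_smat; apply: core_gram.
Qed.

(** If [X = A M^-1 A^*], the congruence identity for [A^*] and [M^-1] reads [A^* X^-1 A = M], and
    this is the equation after moving terms. *)
Lemma F_fix_solves X : I X -> F X X = X -> solves_eq1 s t p A B Q X.
Proof.
move=> hX e; have hM := core_pd X X hX hX.
have := congr_minv (adj A) (minv (M X X)) (invertible_adj _ hA) (pd_invertible _ (pd_minv _ hM)).
rewrite adj_adj -/(core _ _ _ _ _ _ _) (_ : mmul A (mmul (minv (M X X)) (adj A)) = X) //.
have [m1 m2] := minv_invertible _ (pd_invertible _ hM).
rewrite (minv_unique _ _ m2 m1) => e'; rewrite /solves_eq1 e'.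
by apply: mat_ext => i j; rewrite /madd /M /core /msub; ring.
Qed.

Lemma solves_F_fix X : I X -> solves_eq1 s t p A B Q X -> F X X = X.
Proof.
move=> hX e; have pX := pd_interval _ _ _ a0 hX.
have eM : M X X = mmul (adj A) (mmul (minv X) A).
  by rewrite /M /core -{1}e; apply: mat_ext => i j; rewrite /madd /msub; ring.
rewrite /F /Fmap -/(core s t p B Q X X) -/(M X X) eM.
rewrite congr_minv //; last exact/pd_invertible/pd_minv.
by have [m1 m2] := minv_invertible _ (pd_invertible _ pX); apply: minv_unique.
Qed.

(** On the interval [M(X, X)] is largest with [a I, b I] as arguments and smallest with [b I, a I];
    inversion swaps the two ends. Scalar arguments reduce this to the spectral bounds on the powers
    of [X]. *)
Lemma F_bracket X : I X -> F X X = X -> in_interval (F (smat a) (smat b)) (F (smat b) (smat a)) X.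
Proof.
move=> hX e; have Ia : I (smat a) by apply: smat_in_interval; move: ab; lra.
have Ib : I (smat b) by apply: smat_in_interval; move: ab; lra.
have b0 : 0 < b by move: a0 ab; lra.
apply: qform_in_interval; try exact: herm_F; first by case: hX.
move=> v; rewrite -{1 2}e; split; apply: F_antitone => // w;
  rewrite !qform_core !mpow_smat // !qform_smat;
  have := qform_pow_s X w hX; have := qform_pow_p X (mvmul B w) hX; lra.
Qed.

Let delta := 2 * Rmax (s / t * (mnorm A) ^ 2 * / theta ^ 2 * Rpower a (s / t - 1))
                      (p / t * (mnorm A) ^ 2 * (mnorm B) ^ 2 * / theta ^ 2
                         * Rpower a (- p / t - 1)).

Lemma F_contraction X Y X' Y' : I X -> I Y -> I X' -> I Y' ->
  mnorm (msub (F X Y) (F X' Y')) <= delta * Rmax (mnorm (msub X X')) (mnorm (msub Y Y')).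
Proof.
move=> hX hY hX' hY'.
have [m1 m2] := minv_invertible _ (pd_invertible _ (core_pd X Y hX hY)).
have [m1' m2'] := minv_invertible _ (pd_invertible _ (core_pd X' Y' hX' hY')).
(* Resolvent identity, with [M(X',Y') - M(X,Y)] expanded: [Q] cancels and only differences of powers
   remain, the second conjugated by [B]. *)
have E : msub (F X Y) (F X' Y') = mmul A (mmul (mmul (minv (M X Y)) (mmul
    (madd (msub (mpow X (s / t)) (mpow X' (s / t)))
          (mmul (adj B) (mmul (msub (mpow Y (- p / t)) (mpow Y' (- p / t))) B)))
    (minv (M X' Y')))) (adj A)).
  rewrite (_ : madd _ _ = msub (M X' Y') (M X Y)); last first.
    rewrite mmul_msub_l mmul_msub_r.
    by apply: mat_ext => i j; rewrite /M /core /madd /msub; ring.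
  rewrite mmul_msub_l m1' mmul_msub_r mmul_1_r (mmul_assoc (minv (M X Y))) m2 mmul_1_l.
  by rewrite mmul_msub_l mmul_msub_r.
have hh Z (hZ : I Z) : hermitian Z := herm_interval _ _ _ hZ.
have hl Z (hZ : I Z) v := I_lower Z v hZ.
have [b1 _] := mpow_lip X X' a _ (s / t) a0 (mnorm_ge0 _ n1) ltac:(lra) (hh _ hX) (hl _ hX)
  (hh _ hX') (hl _ hX') (mnorm_bound _ n1).
have [_ b2] := mpow_lip Y Y' a _ (p / t) a0 (mnorm_ge0 _ n1) ltac:(lra) (hh _ hY) (hl _ hY)
  (hh _ hY') (hl _ hY') (mnorm_bound _ n1).
rewrite -!neg_div in b2.
have bA := mnorm_bound A n1; have bB := mnorm_bound B n1.
have i1 := bounded_by_minv _ theta th0 (herm_core X Y hX hY) (fun v => core_lower X Y v hX hY).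
have i2 := bounded_by_minv _ theta th0 (herm_core X' Y' hX' hY') (fun v => core_lower X' Y' v hX' hY').
have bd := bounded_by_mmul _ _ _ _ bA (bounded_by_mmul _ _ _ _ (bounded_by_mmul _ _ _ _ i1
  (bounded_by_mmul _ _ _ _ (bounded_by_madd _ _ _ _ b1 (bounded_by_mmul _ _ _ _ (bounded_by_adj _ _ bB)
    (bounded_by_mmul _ _ _ _ b2 bB))) i2)) (bounded_by_adj _ _ bA)).
rewrite E; apply: Rle_trans (mnorm_le _ _ n1 bd) _.
move: (mnorm_ge0 (msub X X') n1) (mnorm_ge0 (msub Y Y') n1).
move: (mnorm (msub X X')) (mnorm (msub Y Y')) => e1 e2 e10 e20.
set c1 := s / t * mnorm A ^ 2 * / theta ^ 2 * Rpower a (s / t - 1).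
set c2 := p / t * mnorm A ^ 2 * mnorm B ^ 2 * / theta ^ 2 * Rpower a (- p / t - 1).
(* The sum of the two contributions is at most twice the product of the maxima; this is the origin
   of the factor 2 in [delta]. *)
apply: (Rle_trans _ (c1 * e1 + c2 * e2)).
  (* That [t] is nonzero follows from [0 < s / t], as the inverse of 0 is 0. *)
  by right; rewrite /c1 /c2; field; split; [lra | move=> t0; move: hs; rewrite t0 /Rdiv Rinv_0; lra].
have it0 : 0 < / theta ^ 2 by apply: Rinv_0_lt_compat; nra.
have A0 : 0 <= mnorm A ^ 2 by nra.
have B0 : 0 <= mnorm B ^ 2 by nra.
have pw x : 0 <= Rpower a x by apply/Rlt_le/Rpower_pos.
have c10 : 0 <= c1.
  by do 3 (apply: Rmult_le_pos => //; try lra).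
have c20 : 0 <= c2.
  by do 4 (apply: Rmult_le_pos => //; try lra).
rewrite /delta -/c1 -/c2.
have := Rmax_l c1 c2; have := Rmax_r c1 c2; have := Rmax_l e1 e2; have := Rmax_r e1 e2.
move: (Rmax c1 c2) (Rmax e1 e2) => c e h1 h2 h3 h4.
have := Rmult_le_compat _ _ _ _ c10 e10 h4 h2.
have := Rmult_le_compat _ _ _ _ c20 e20 h3 h1.
lra.
Qed.

End Setting.

(** * The constant [delta], decay of the error, and the main result *)

(** With [x = |A|^2] and [y = |B|^2], condition (iii) puts the first entry of the maximum below 1/2.
    Condition (iv) puts the second below or equal to the first, because
    [a^(s/t-1) = a^((p+s)/t) a^(-p/t-1)]. *)
Lemma contraction_constant_lt1 s t p a theta x y : 0 < t -> 0 < theta -> 0 < a ->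
  0 <= x ->
  s * x < / 2 * t * theta ^ 2 * Rpower a (1 - s / t) ->
  p * y < s * Rpower a ((p + s) / t) ->
  2 * Rmax (s / t * x * / theta ^ 2 * Rpower a (s / t - 1))
           (p / t * x * y * / theta ^ 2 * Rpower a (- p / t - 1)) < 1.
Proof.
move=> t0 th0 a0 x0 h3 h4.
have it : 0 < / t := Rinv_0_lt_compat _ t0.
have ith : 0 < / theta ^ 2 by apply: Rinv_0_lt_compat; nra.
have P0 := Rpower_pos a (s / t - 1).
have PP : Rpower a (1 - s / t) * Rpower a (s / t - 1) = 1.
  by rewrite -Rpower_plus (_ : _ + _ = 0) ?Rpower_O //; ring.
have c1 : s / t * x * / theta ^ 2 * Rpower a (s / t - 1) < / 2.
  have k0 : 0 < / t * / theta ^ 2 * Rpower a (s / t - 1).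
    by apply: Rmult_lt_0_compat => //; apply: Rmult_lt_0_compat.
  have := Rmult_lt_compat_r _ _ _ k0 h3.
  rewrite (_ : / 2 * _ * _ * _ * _ = / 2 * (Rpower a (1 - s / t) * Rpower a (s / t - 1))); last by field; lra.
  by rewrite PP; move=> h; apply: Rle_lt_trans (Rlt_le_trans _ _ _ h _); [right; field|]; lra.
have c2 : p / t * x * y * / theta ^ 2 * Rpower a (- p / t - 1)
          <= s / t * x * / theta ^ 2 * Rpower a (s / t - 1).
  have -> : Rpower a (s / t - 1) = Rpower a ((p + s) / t) * Rpower a (- p / t - 1).
    by rewrite -Rpower_plus; congr Rpower; field; lra.
  have k0 : 0 <= / t * x * / theta ^ 2 * Rpower a (- p / t - 1).
    apply: Rmult_le_pos; last exact/Rlt_le/Rpower_pos.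
    by do 2 (apply: Rmult_le_pos; try lra).
  have := Rmult_le_compat_r _ _ _ k0 (Rlt_le _ _ h4).
  by move=> h; apply: Rle_trans (Rle_trans _ _ _ h _); right; field; lra.
by apply: (Rlt_le_trans _ (2 * / 2)); [apply: Rmult_lt_compat_l; [lra | apply: Rmax_lub_lt; lra] | lra].
Qed.

(** [E 0 <= D + E 1 <= D + delta E 0] bounds [E 0] by [D / (1 - delta)]; this gives an error bound
    in terms of the first step alone. *)
Lemma geometric_decay (E : nat -> R) delta D : 0 <= delta < 1 ->
  (forall k, E (S k) <= delta * E k) -> E 0%nat <= D + E 1%nat ->
  forall k, E k <= delta ^ k / (1 - delta) * D.
Proof.
move=> hd hE h0 k.
have e0 : E 0%nat <= / (1 - delta) * D.
  have := hE 0%nat => h1; apply: (Rmult_le_reg_l (1 - delta)); first lra.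
  by rewrite -Rmult_assoc Rinv_r; lra.
elim: k => [|k IH]; first by rewrite /= /Rdiv Rmult_1_l.
apply: Rle_trans (hE k) _; apply: Rle_trans (Rmult_le_compat_l _ _ _ (proj1 hd) IH) _.
by right; rewrite /= /Rdiv; ring.
Qed.

(** The substitution [X |-> X^(1/t)] only rescales exponents once the inverse is read as the power
    -1. *)
Lemma solves_eq2_mpow {n} s t p (A B Q X : Mat n) : 0 < t -> pd X ->
  solves_eq2 s t p A B Q (mpow X (1 / t)) <-> solves_eq1 s t p A B Q X.
Proof.
move=> t0 hX.
have e1 : 1 / t * s = s / t by field; lra.
have e2 : 1 / t * - t = -1 by field; lra.
have e3 : 1 / t * - p = - p / t by field; lra.
by rewrite /solves_eq2 /solves_eq1 !mpow_mpow // minv_mpow // e1 e2 e3.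
Qed.

Theorem mainTheorem14 (n : nat) (s t p : R) (A B Q : Mat n) (b : R) :
  (1 <= n)%nat ->
  1 <= s -> 1 <= t -> 1 <= p -> s <= t -> p <= t ->
  invertible A -> invertible B -> pd Q ->
  0 < b ->
  let a := lmin (mmul A (mmul (minv Q) (adj A))) in
  let theta := / b * lmin (mmul (adj A) A) in
  (* (i) *) b > a ->
  (* (ii) *) mle (madd (madd (mmul (smat (/ b)) (mmul (adj A) A)) (smat (Rpower b (s / t))))
                       (mmul (smat (Rpower a (- p / t))) (mmul (adj B) B))) Q ->
  (* (iii) *) s * (mnorm A) ^ 2 < / 2 * t * theta ^ 2 * Rpower a (1 - s / t) ->
  (* (iv) *) p * (mnorm B) ^ 2 < s * Rpower a ((p + s) / t) ->
  let F := Fmap s t p A B Q in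
  let X_ := fun k => fst (iterXY s t p A B Q a b k) in
  let Y_ := fun k => snd (iterXY s t p A B Q a b k) in
  let delta := 2 * Rmax (s / t * (mnorm A) ^ 2 * / theta ^ 2 * Rpower a (s / t - 1))
                        (p / t * (mnorm A) ^ 2 * (mnorm B) ^ 2 * / theta ^ 2
                           * Rpower a (- p / t - 1)) in
  exists Xbar : Mat n,
    (* (I) *)
    pd Xbar /\ in_interval (smat a) (smat b) Xbar /\
    solves_eq1 s t p A B Q Xbar /\ F Xbar Xbar = Xbar /\
    (forall X : Mat n, pd X -> in_interval (smat a) (smat b) X ->
        solves_eq1 s t p A B Q X -> X = Xbar) /\
    (forall X : Mat n, in_interval (smat a) (smat b) X -> F X X = X -> X = Xbar) /\
    (* (II) *)
    in_interval (F (smat a) (smat b)) (F (smat b) (smat a)) Xbar /\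
    (* (III) *)
    (forall eps, 0 < eps -> exists N : nat, forall k, (N <= k)%nat ->
        mnorm (msub (X_ k) Xbar) < eps /\ mnorm (msub (Y_ k) Xbar) < eps) /\
    delta < 1 /\
    (forall k : nat,
        Rmax (mnorm (msub (X_ k) Xbar)) (mnorm (msub (Y_ k) Xbar)) <=
        delta ^ k / (1 - delta) *
        Rmax (mnorm (msub (X_ 1%nat) (X_ 0%nat))) (mnorm (msub (Y_ 1%nat) (Y_ 0%nat)))) /\
    (* consequence *)
    (let Z := mpow Xbar (1 / t) in
     pd Z /\ in_interval (smat (Rpower a (1 / t))) (smat (Rpower b (1 / t))) Z /\
     solves_eq2 s t p A B Q Z /\
     (forall Z' : Mat n, pd Z' ->
        in_interval (smat (Rpower a (1 / t))) (smat (Rpower b (1 / t))) Z' ->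
        solves_eq2 s t p A B Q Z' -> Z' = Z)).
Proof.
move=> n1 s1 t1 p1 st pt hA hB hQ b0 a theta hab h2 h3 h4 F X_ Y_ delta.
have t0 : 0 < t by lra.
have it0 : 0 < / t := Rinv_0_lt_compat _ t0.
have frac x : 1 <= x -> x <= t -> 0 < x / t <= 1.
  move=> x1 xt; split; first by apply: Rmult_lt_0_compat; lra.
  by apply: (Rmult_le_reg_r t) => //; rewrite /Rdiv Rmult_assoc Rinv_l; lra.
(* A congruence of [Q^-1] by [A^*]; its positive definiteness is what makes [a] positive. *)
have pAQ : pd (mmul A (mmul (minv Q) (adj A))).
  by rewrite -{1}(adj_adj A); apply: pd_congr; [exact: pd_minv | exact: invertible_adj].
have pAA := pd_gram _ hA.
have a0 : 0 < a by apply: lmin_pos.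
have H : setting s t p A B Q a b theta.
  split=> //; try exact: frac.
  - apply: Rmult_lt_0_compat; [exact: Rinv_0_lt_compat | exact: lmin_pos].
  - by case: (lmin_spec _ n1 (proj1 pAQ)).
  - move=> v; rewrite Rmult_assoc -qform_gram; apply: Rmult_le_compat_l.
      exact/Rlt_le/Rinv_0_lt_compat.
    by case: (lmin_spec _ n1 (proj1 pAA)).
  - move=> v; have := mle_qform _ _ h2 v.
    by rewrite !qform_madd !qform_smat_mul qform_smat !qform_gram.
have th0 : 0 < theta by case: H.
have d1 : delta < 1.
  by apply: contraction_constant_lt1 => //; apply: pow2_ge_0.
have d0 : 0 <= delta.
  apply: Rmult_le_pos; first lra.
  apply: Rle_trans (Rmax_l _ _).
  have [fs _] := frac s s1 st.
  have A0 := pow2_ge_0 (mnorm A).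
  have ith : 0 < / theta ^ 2 by apply: Rinv_0_lt_compat; nra.
  apply: Rmult_le_pos; last exact/Rlt_le/Rpower_pos.
  by do 2 (apply: Rmult_le_pos; try lra).
have n_smat c : hermitian (@smat n c) := herm_diag _.
have Ia : in_interval (@smat n a) (smat b) (smat a) by apply: smat_in_interval; lra.
have Ib : in_interval (@smat n a) (smat b) (smat b) by apply: smat_in_interval; lra.
(* On the diagonal the two distances in the maximum coincide, so [X |-> F(X, X)] contracts by
   [delta]. *)
have contr X Y (hX : in_interval (smat a) (smat b) X) (hY : in_interval (smat a) (smat b) Y) :
    mnorm (msub (F X X) (F Y Y)) <= delta * mnorm (msub X Y).
  have := F_contraction H X X Y Y hX hX hY hY.
  by rewrite [X in _ * X]Rmax_left //; apply: Rle_refl.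
have [L [LI FL]] := interval_contraction_fixpoint (smat a) (smat b) (smat a) (fun X => F X X) delta
  n1 (conj d0 d1) (n_smat a) (n_smat b) Ia (fun X hX => F_interval H X X hX hX) contr.
have uniq X : in_interval (smat a) (smat b) X -> F X X = X -> X = L.
  move=> hX eX; apply: mnorm_msub_eq0 => //.
  have := contr X L hX LI; rewrite eX FL; have := mnorm_ge0 (msub X L) n1; nra.
have pL := pd_interval _ _ _ a0 LI.
pose E k := Rmax (mnorm (msub (X_ k) L)) (mnorm (msub (Y_ k) L)).
have XS k : X_ (S k) = F (X_ k) (Y_ k) by rewrite /X_ /Y_ /=; case: iterXY.
have YS k : Y_ (S k) = F (Y_ k) (X_ k) by rewrite /X_ /Y_ /=; case: iterXY.
have XYI k : in_interval (smat a) (smat b) (X_ k) /\ in_interval (smat a) (smat b) (Y_ k).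
  by elim: k => [//|k [IX IY]]; rewrite XS YS; split; apply: (F_interval H).
have ES k : E (S k) <= delta * E k.
  (* Both new iterates are compared with [L = F(L, L)]; the second has its arguments exchanged,
     which the maximum does not see. *)
  have [IX IY] := XYI k; rewrite /E XS YS -{1 2}FL; apply: Rmax_lub.
    exact: (F_contraction H).
  by rewrite (Rmax_comm (mnorm (msub (X_ k) L))); apply: (F_contraction H).
(* The starting inequality [E 0 <= D + E 1] is the triangle inequality through [X_1] and [Y_1]. *)
have Ebound : forall k, E k <= delta ^ k / (1 - delta) *
    Rmax (mnorm (msub (X_ 1%nat) (X_ 0%nat))) (mnorm (msub (Y_ 1%nat) (Y_ 0%nat))).
  apply: geometric_decay => //; apply: Rmax_lub.
    apply: Rle_trans (mnorm_triangle _ (X_ 1%nat) _ n1) _.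
    by rewrite mnorm_msubC //; apply: Rplus_le_compat; apply: Rmax_l.
  apply: Rle_trans (mnorm_triangle _ (Y_ 1%nat) _ n1) _.
  by rewrite mnorm_msubC //; apply: Rplus_le_compat; apply: Rmax_r.
have Z0 x : 0 < Rpower x (1 / t) := Rpower_pos _ _.
have eb c : 0 < c -> Rpower (Rpower c (1 / t)) t = c.
  by move=> c0; rewrite Rpower_mult (_ : 1 / t * t = 1) ?Rpower_1 //; field; lra.
exists L; split; [exact: pL | split; [exact: LI | split; [exact: F_fix_solves H L LI FL |]]].
split; [exact: FL | split; [|split; [exact: uniq |]]].
  by move=> X _ hX hsol; apply: uniq => //; apply: solves_F_fix H X hX hsol.
split; first exact: F_bracket H L LI FL.
split.
  set D := Rmax (mnorm (msub (X_ 1%nat) (X_ 0%nat))) (mnorm (msub (Y_ 1%nat) (Y_ 0%nat))) in Ebound.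
  have cv : Un_cv (fun k => delta ^ k / (1 - delta) * D) 0.
    rewrite -(Rmult_0_l D); apply: CV_mult; last exact: Un_cv_const.
    rewrite -(Rmult_0_l (/ (1 - delta))); apply: CV_mult; last exact: Un_cv_const.
    move=> e e0; have [N hN] := pow_lt_1_zero delta ltac:(rewrite Rabs_pos_eq; lra) e e0.
    by exists N => k kN; rewrite /Rdist Rminus_0_r; apply: hN.
  move=> eps eps0; have [N hN] := cv eps eps0; exists N => k kN.
  have := hN k kN; rewrite /Rdist Rminus_0_r => /(Rle_lt_trans _ _ _ (Rle_abs _)).
  move=> /(Rle_lt_trans _ _ _ (Ebound k)) h.
  by split; apply: Rle_lt_trans h; [apply: Rmax_l | apply: Rmax_r].
split; first exact: d1.
split; first exact: Ebound.
move=> Z; split; first exact: pd_mpow.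
split; first by apply: mpow_interval => //; have := frac 1 (Rle_refl 1) t1; lra.
split; first exact: (proj2 (solves_eq2_mpow s t p A B Q L t0 pL) (F_fix_solves H L LI FL)).
move=> Z' pZ' IZ' hZ'.
have eZ : Z' = mpow (mpow Z' t) (1 / t).
  by rewrite mpow_mpow // (_ : t * (1 / t) = 1) ?mpow_1 //; field; lra.
(* Raising to the power [t >= 1] preserves the bounds because the endpoints are scalar; uniqueness
   for the first equation then applies to [Z'^t]. *)
have IY : in_interval (smat a) (smat b) (mpow Z' t).
  by rewrite -(eb a) // -(eb b) //; apply: mpow_interval => //; lra.
rewrite eZ /Z; congr mpow; apply: uniq => //; apply: (solves_F_fix H) => //.
apply: (proj1 (solves_eq2_mpow s t p A B Q _ t0 (pd_mpow _ t pZ'))).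
by rewrite -eZ.
Qed.
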